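(* Let $E$ be an exact Courant algebroid over a smooth manifold $M$, let $G$ be a generalized metric on $E$ and let $\mathcal{J}$ be a $G$-orthogonal almost generalized complex structure. Let $D$ be the generalized Bismut connection of $G$. Then $(\mathcal{J},G)$ defines a generalized Kähler structure if and only if $D\mathcal{J}=0$ and the torsion $T_D\in C^\infty(\wedge^3E)$ is of type $(2,1)+(1,2)$ with respect to $\mathcal{J}$.
   Context: An exact Courant algebroid is an extension $0\to T^*\xrightarrow{\pi^*}E\xrightarrow{\pi}T\to0$ over $M$ with a nondegenerate symmetric pairing $\langle\cdot,\cdot\rangle$ of split signature with $\langle\pi^*\xi,a\rangle=\xi(\pi(a))$ and a bracket on $C^\infty(E)$ satisfying: $[[a,b],c]=[a,[b,c]]-[b,[a,c]]$; $[a,fb]=f[a,b]+(\pi(a)f)b$; $\pi(a)\langle b,c\rangle=\langle[a,b],c\rangle+\langle b,[a,c]\rangle$; $[a,a]=\tfrac12\pi^*d\langle a,a\rangle$. A generalized metric is a maximal positive-definite subbundle $C_+\subset E$, with $C_-=C_+^\perp$, equivalently the positive-definite metric $G=\langle\cdot,\cdot\rangle|_{C_+}-\langle\cdot,\cdot\rangle|_{C_-}$; as an endomorphism, $G=\pm1$ on $C_\pm$. The $G$-orthogonal complement of $T^*$ is isotropic and identified with $T$, so $E=T\oplus T^*$; let $C(X+\xi)=X-\xi$ in this splitting ($C$ exchanges $C_\pm$). With subscripts $\pm$ denoting projection to $C_\pm$, the generalized Bismut connection is $$D_Z(W)=[Z_-,W_+]_+ + [Z_+,W_-]_- + [CZ_-,W_-]_-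 + [CZ_+,W_+]_+ .$$ Its torsion is $$T_D(a,b,c)=\langle D_ab-D_ba-[a,b]_{sk},c\rangle+\tfrac12\big(\langle D_ca,b\rangle-\langle D_cb,a\rangle\big),\quad [a,b]_{sk}=\tfrac12([a,b]-[b,a]),$$ which is totally skew and, using $E\cong E^*$ via $\langle\cdot,\cdot\rangle$, is a section of $\wedge^3E$. $D\mathcal{J}=0$ means $D_x(\mathcal{J}y)=\mathcal{J}(D_xy)$ for all $x,y\in C^\infty(E)$. An almost generalized complex structure is a $\langle\cdot,\cdot\rangle$-orthogonal map $\mathcal{J}:E\to E$ with $\mathcal{J}^2=-1$; it is a generalized complex structure if its $+i$-eigenbundle $L\subset E\otimes\mathbb{C}$ is closed under the Courant bracket. $G$-orthogonal means orthogonal for $G$ (equivalently $\mathcal{J}$ preserves $C_\pm$). The type decomposition of $\wedge^3E\otimes\mathbb{C}$ is that induced by $E\otimes\mathbb{C}=L\oplus\overline L$. A generalized Kähler structure is a pair $(\mathcal{J}_A,\mathcal{J}_B)$ of commuting generalized complex structures such that $\langle\mathcal{J}_A\cdot,\mathcal{J}_B\cdot\rangle$ is a generalized metric (i.e. is of the form $G$ above). $(\mathcal{J},G)$ defines a generalized Kähler structure if $(\mathcal{J},\mathcal{J}')$, with $\mathcal{J}'=G\mathcal{J}$, is one. *)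

(* Defs.v *)
From HB Require Import structures.
From mathcomp Require Import all_boot all_order all_algebra sesquilinear.
From mathcomp Require Import all_classical all_reals all_analysis.
From mathcomp Require Import complex.

Set Implicit Arguments.
Unset Strict Implicit.
Unset Printing Implicit Defensive.

Import Order.TTheory GRing.Theory Num.Theory.
Import numFieldNormedType.Exports.

Local Open Scope classical_set_scope.
Local Open Scope ring_scope.

(* [A] is meant to be open.  In finite dimension, asking that every
   [x |-> 'd f x v] be C^k is the same as asking that the derivative
   ['d f] be C^k. *)
Fixpoint Ck (R : realType) (V W : normedModType R) (k : nat)
    (A : set V) (f : V -> W) : Prop :=
  if k is k'.+1 then
    (forall x, A x -> differentiable f x) /\
    (forall v : V, Ck k' A (fun x => 'd f x v))
  else forall x, A x -> {for x, continuous f}.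

Definition Cinfty (R : realType) (V W : normedModType R)
    (A : set V) (f : V -> W) : Prop := forall k, Ck k A f.

(* [coord i] and [param i] are only meaningful on [dom i] and on its image.
   [chart_at] selects a chart around each point; it is used to represent
   tangent vectors by their coordinates. *)
Record manifold (R : realType) (n : nat) := Manifold {
  points :> topologicalType;
  points_hausdorff : hausdorff_space points;
  points_second_countable : @second_countable points;
  atlas : Type;
  dom : atlas -> set points;
  coord : atlas -> points -> 'rV[R]_n;
  param : atlas -> 'rV[R]_n -> points;
  chart_at : points -> atlas;
  mem_chart_at : forall x, dom (chart_at x) x;
  dom_open : forall i, open (dom i);
  coord_open : forall i, open (coord i @` dom i);
  coordK : forall i x, dom i x -> param i (coord i x) = x;
  coord_continuous : forall i x, dom i x -> {for x, continuous (coord i)};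
  param_continuous : forall i x, dom i x ->
    {for coord i x, continuous (param i)};
  transition_smooth : forall i j,
    Cinfty (coord i @` (dom i `&` dom j)) (coord j \o param i)
}.

Section Manifold.
Variables (R : realType) (n : nat) (M : manifold R n).

Definition smooth_map_on (W : normedModType R) (U : set M) (f : M -> W) :=
  forall i, Cinfty (coord i @` (U `&` dom i)) (f \o param i).

Definition smooth_function (f : M -> R) :=
  smooth_map_on setT (f : M -> R^o).

(* Tangent vectors at [x] are given by their components in [chart_at x]. *)
Definition tangent (x : M) : vectType R := 'rV[R]_n.
Definition cotangent (x : M) : vectType R := 'Hom(tangent x, R^o).

Definition differential (f : M -> R) (x : M) : cotangent x :=
  linfun ('d (f \o param (chart_at x) : 'rV[R]_n -> R^o)
             (coord (chart_at x) x)).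

(* The components of [v : tangent x] in an arbitrary chart [i] around [x]. *)
Definition components (i : atlas M) (x : M) (v : tangent x) : 'rV[R]_n :=
  'd (coord i \o param (chart_at x)) (coord (chart_at x) x) v.

Definition smooth_vector_field_on (U : set M) (X : forall x, tangent x) :=
  forall i, smooth_map_on (U `&` dom i) (fun x => components i (X x)).

End Manifold.

Record vector_bundle (R : realType) (n : nat) (M : manifold R n) :=
  VectorBundle {
  fiber :> M -> vectType R;
  bundle_rank : nat;
  triv_index : Type;
  triv_dom : triv_index -> set M;
  triv : forall (i : triv_index) (x : M), 'Hom(fiber x, 'rV[R]_bundle_rank);
  triv_open : forall i, open (triv_dom i);
  triv_cover : forall x, exists i, triv_dom i x;
  triv_bij : forall i x, triv_dom i x -> bijective (triv i x);
  triv_smooth : forall i j (v : 'rV[R]_bundle_rank),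
    smooth_map_on (triv_dom i `&` triv_dom j)
      (fun x => triv j x ((triv i x)^-1%VF v))
}.

Section VectorBundle.
Variables (R : realType) (n : nat) (M : manifold R n) (E : vector_bundle M).

Definition bsection := forall x : M, E x.

Definition smooth_section_on (U : set M) (s : bsection) :=
  forall i, smooth_map_on (U `&` triv_dom i) (fun x => triv i x (s x)).

Definition smooth_section (s : bsection) := smooth_section_on setT s.

Definition sadd (a b : bsection) : bsection := fun x => a x + b x.
Definition sscale (f : M -> R) (a : bsection) : bsection :=
  fun x => f x *: a x.

Definition endomorphism := forall x : M, 'End(E x).

Definition sapply (F : endomorphism) (s : bsection) : bsection :=
  fun x => F x (s x).

Definition smooth_endomorphism (F : endomorphism) :=
  forall (U : set M) (s : bsection), open U ->
    smooth_section_on U s -> smooth_section_on U (sapply F s).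

Definition smooth_subbundle (S : forall x, {vspace E x}) :=
  forall x, exists (U : set M) (k : nat) (s : 'I_k -> bsection),
    [/\ open U, U x, forall i, smooth_section_on U (s i) &
        forall y, U y -> basis_of (S y) [tuple s i y | i < k]].

End VectorBundle.

Section Fiber.
Variables (R : realType) (V : vectType R) (B : {symmetric V}).

Definition positive_definite (U : {vspace V}) :=
  forall u, u \in U -> u != 0 -> 0 < B u u.

Definition negative_definite (U : {vspace V}) :=
  forall u, u \in U -> u != 0 -> B u u < 0.

Definition split_signature :=
  exists P N : {vspace V}, [/\ positive_definite P, negative_definite N,
    (P + N)%VS = fullv & \dim P = \dim N].

Variable Cp : {vspace V}.

Definition proj_plus : 'End(V) := daddv_pi Cp (orthov B Cp).
Definition proj_minus : 'End(V) := daddv_pi (orthov B Cp) Cp.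

Definition metric_endo : 'End(V) := proj_plus - proj_minus.

Definition metric_form (a b : V) : R :=
  B (proj_plus a) (proj_plus b) - B (proj_minus a) (proj_minus b).

Lemma metric_form_bilinear :
  bilinear_for (GRing.Scale.Law.clone _ _ ( *%R : R -> R -> R) _)
               (GRing.Scale.Law.clone _ _ (idfun \; *%R : R -> R -> R) _)
               metric_form.
Proof.
split=> c k a b; rewrite /metric_form (linearP proj_plus) (linearP proj_minus).
  by rewrite !linearPl /= mulrBr opprD addrACA.
by rewrite !linearPr /= mulrBr opprD addrACA.
Qed.

HB.instance Definition _ :=
  bilinear_isBilinear.Build R V V R _ _ metric_form metric_form_bilinear.

Lemma metric_form_hermitian (a b : V) :
  metric_form a b = (-1) ^+ false * idfun (metric_form b a).
Proof.
by rewrite /metric_form expr0 mul1r hermC expr0 mul1r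
  [X in _ - X]hermC expr0 mul1r.
Qed.

HB.instance Definition _ :=
  isHermitianSesquilinear.Build R V false idfun metric_form
    metric_form_hermitian.

End Fiber.

(* The bracket is a total function on set-theoretic sections; only its values
   on smooth sections are constrained or used.  Smoothness of [coanchor]
   follows from [coanchorE], [pairing_nondegenerate] and smoothness of
   [anchor] and [pairing]. *)
Record exact_courant (R : realType) (n : nat) (M : manifold R n) :=
  ExactCourant {
  courant_bundle :> vector_bundle M;
  anchor : forall x, 'Hom(courant_bundle x, tangent x);
  coanchor : forall x, 'Hom(cotangent x, courant_bundle x);
  pairing : forall x, {symmetric (courant_bundle x)};
  bracket : bsection courant_bundle -> bsection courant_bundle ->
            bsection courant_bundle;

  anchor_smooth : forall (U : set M) a, open U -> smooth_section_on U a ->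
    smooth_vector_field_on U (fun x => anchor x (a x));
  pairing_smooth : forall (U : set M) a b, open U ->
    smooth_section_on U a -> smooth_section_on U b ->
    smooth_map_on U (fun x => pairing x (a x) (b x) : R^o);
  bracket_smooth : forall a b, smooth_section a -> smooth_section b ->
    smooth_section (bracket a b);

  coanchor_inj : forall x, lker (coanchor x) = 0%VS;
  exactness : forall x, limg (coanchor x) = lker (anchor x);
  anchor_surj : forall x, limg (anchor x) = fullv;

  pairing_nondegenerate : forall x, nondegenerate (pairing x);
  pairing_split : forall x, split_signature (pairing x);
  coanchorE : forall x (xi : cotangent x) (a : courant_bundle x),
    pairing x (coanchor x xi) a = xi (anchor x a);

  bracketPl : forall (k : R) a b c,
    smooth_section a -> smooth_section b -> smooth_section c -> forall x,
    bracket (sadd (sscale (fun=> k) a) b) c x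
      = k *: bracket a c x + bracket b c x;
  bracketPr : forall (k : R) a b c,
    smooth_section a -> smooth_section b -> smooth_section c -> forall x,
    bracket c (sadd (sscale (fun=> k) a) b) x
      = k *: bracket c a x + bracket c b x;

  bracket_jacobi : forall a b c,
    smooth_section a -> smooth_section b -> smooth_section c -> forall x,
    bracket (bracket a b) c x
      = bracket a (bracket b c) x - bracket b (bracket a c) x;
  bracket_leibniz : forall a b (f : M -> R),
    smooth_section a -> smooth_section b -> smooth_function f -> forall x,
    bracket a (sscale f b) x
      = f x *: bracket a b x + (differential f x (anchor x (a x)) : R) *: b x;
  bracket_pairing : forall a b c,
    smooth_section a -> smooth_section b -> smooth_section c -> forall x,
    differential (fun y => pairing y (b y) (c y)) x (anchor x (a x))
      = pairing x (bracket a b x) (c x) + pairing x (b x) (bracket a c x);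
  bracket_diag : forall a, smooth_section a -> forall x,
    bracket a a x
      = 2^-1 *: coanchor x (differential (fun y => pairing y (a y) (a y)) x)
}.

(* [Cplus] is maximal among positive-definite subspaces in each fibre, i.e. its
   rank is half that of [E]. *)
Record generalized_metric (R : realType) (n : nat) (M : manifold R n)
    (E : exact_courant M) := GeneralizedMetric {
  Cplus : forall x, {vspace E x};
  Cplus_smooth : smooth_subbundle Cplus;
  Cplus_positive : forall x, positive_definite (pairing E x) (Cplus x);
  Cplus_maximal : forall x (U : {vspace E x}),
    positive_definite (pairing E x) U -> (Cplus x <= U)%VS -> U = Cplus x
}.

Section Bismut.
Variables (R : realType) (n : nat) (M : manifold R n) (E : exact_courant M).
Variable G : generalized_metric E.

Definition Pplus : endomorphism E :=
  fun x => proj_plus (pairing E x) (Cplus G x).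
Definition Pminus : endomorphism E :=
  fun x => proj_minus (pairing E x) (Cplus G x).
Definition Gendo : endomorphism E :=
  fun x => metric_endo (pairing E x) (Cplus G x).
Definition Gform (x : M) : {symmetric (E x)} :=
  metric_form (pairing E x) (Cplus G x).

Definition cotangent_part (x : M) : {vspace E x} := limg (coanchor E x).
Definition tangent_part (x : M) : {vspace E x} :=
  orthov (Gform x) (cotangent_part x).

(* [X + xi |-> X - xi] *)
Definition splitting_involution : endomorphism E := fun x =>
  daddv_pi (tangent_part x) (cotangent_part x)
  - daddv_pi (cotangent_part x) (tangent_part x).

Definition bismut (Z W : bsection E) : bsection E :=
  let Zp := sapply Pplus Z in let Zm := sapply Pminus Z in
  let Wp := sapply Pplus W in let Wm := sapply Pminus W in
  let C := sapply splitting_involution in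
  fun x =>
    Pplus x (bracket Zm Wp x) + Pminus x (bracket Zp Wm x)
    + Pminus x (bracket (C Zm) Wm x) + Pplus x (bracket (C Zp) Wp x).

End Bismut.

Section Torsion.
Variables (R : realType) (n : nat) (M : manifold R n) (E : exact_courant M).

Definition skew_bracket (a b : bsection E) : bsection E :=
  fun x => 2^-1 *: (bracket a b x - bracket b a x).

Definition torsion (D : bsection E -> bsection E -> bsection E)
    (a b c : bsection E) (x : M) : R :=
  pairing E x (D a b x - D b a x - skew_bracket a b x) (c x)
  + 2^-1 * (pairing E x (D c a x) (b x) - pairing E x (D c b x) (a x)).

Definition parallel (D : bsection E -> bsection E -> bsection E)
    (J : endomorphism E) :=
  forall a b, smooth_section a -> smooth_section b ->
  forall x, D a (sapply J b) x = J x (D a b x).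

End Torsion.

Section Complexification.
Variables (R : realType) (n : nat) (M : manifold R n) (E : exact_courant M).
Local Notation C := R[i].
Local Notation iC := (Complex (0 : R) 1).

(* [(a, b)] stands for the section [a + i b] of the complexified bundle. *)
Definition csection := (bsection E * bsection E)%type.

Definition smooth_csection (u : csection) :=
  smooth_section u.1 /\ smooth_section u.2.

Definition csadd (u v : csection) : csection :=
  (sadd u.1 v.1, sadd u.2 v.2).

Definition csscale (z : C) (u : csection) : csection :=
  let: Complex p q := z in
  (fun x => p *: u.1 x - q *: u.2 x, fun x => p *: u.2 x + q *: u.1 x).

Definition csapply (F : endomorphism E) (u : csection) : csection :=
  (sapply F u.1, sapply F u.2).

Definition cbracket (u v : csection) : csection :=
  (fun x => bracket u.1 v.1 x - bracket u.2 v.2 x,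
   fun x => bracket u.1 v.2 x + bracket u.2 v.1 x).

Definition ctrilinear (T : bsection E -> bsection E -> bsection E -> M -> R)
    (u v w : csection) (x : M) : C :=
  Complex
    (T u.1 v.1 w.1 x - T u.1 v.2 w.2 x - T u.2 v.1 w.2 x - T u.2 v.2 w.1 x)
    (T u.2 v.1 w.1 x + T u.1 v.2 w.1 x + T u.1 v.1 w.2 x - T u.2 v.2 w.2 x).

Variable J : endomorphism E.

Definition in_L (u : csection) := csapply J u = csscale iC u.

(* [L] being the [+i]-eigenbundle of [J], the projection to [L] along its
   conjugate ([bar = false]),
   and to the conjugate of [L] along [L] ([bar = true]). *)
Definition type_proj (bar : bool) (u : csection) : csection :=
  csscale 2^-1
    (csadd u (csscale (if bar then iC else - iC) (csapply J u))).

(* The component of type [(p, 3 - p)] of a section of the third exterior power,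
   seen as a trilinear form through [E = E^*].  As [L] is isotropic, a factor
   in [L] is a functional which vanishes on [L], i.e., which only sees the
   projection to the conjugate of [L]. *)
Definition type_component (p : nat) (T : csection -> csection -> csection ->
    M -> C) (u v w : csection) (x : M) : C :=
  \sum_(e : bool * bool * bool | (e.1.1 + e.1.2 + e.2 == p)%N)
    T (type_proj e.1.1 u) (type_proj e.1.2 v) (type_proj e.2 w) x.

Definition of_type_21_12 (T : bsection E -> bsection E -> bsection E -> M -> R)
  := forall u v w, smooth_csection u -> smooth_csection v ->
     smooth_csection w -> forall x,
     ctrilinear T u v w x
       = type_component 2 (ctrilinear T) u v w x
         + type_component 1 (ctrilinear T) u v w x.

End Complexification.

Section GeneralizedComplex.
Variables (R : realType) (n : nat) (M : manifold R n) (E : exact_courant M).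

Definition almost_generalized_complex (J : endomorphism E) :=
  [/\ smooth_endomorphism J,
      forall x (a b : E x), pairing E x (J x a) (J x b) = pairing E x a b &
      forall x (a : E x), J x (J x a) = - a].

Definition generalized_complex (J : endomorphism E) :=
  almost_generalized_complex J /\
  forall u v : csection E, smooth_csection u -> smooth_csection v ->
    in_L J u -> in_L J v -> in_L J (cbracket u v).

Definition metric_orthogonal (G : generalized_metric E) (J : endomorphism E) :=
  forall x (a b : E x), Gform G x (J x a) (J x b) = Gform G x a b.

Definition generalized_kahler (JA JB : endomorphism E) :=
  [/\ generalized_complex JA, generalized_complex JB,
      forall x (a : E x), JA x (JB x a) = JB x (JA x a) &
      exists G : generalized_metric E, forall x (a b : E x),
        pairing E x (JA x a) (JB x b) = Gform G x a b].

Definition defines_generalized_kahler (J : endomorphism E)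
    (G : generalized_metric E) :=
  generalized_kahler J (fun x => (Gendo G x \o J x)%VF).

End GeneralizedComplex.

(* Main.v *)
(* [L] consists of the sections [a - i J a] with [a] real, so [J] is integrable
   iff its Nijenhuis tensor [N_J] vanishes on real sections; [N_J] is skew as
   [J] is orthogonal.  Let [P], [Q] be the projections to [C_+], [C_-].

   As [C] exchanges [C_+] and [C_-], [D] only involves the operators
   [P [Z, W]] ([Z] in [C_-], [W] in [C_+]) and [Q [Z, W]] ([Z] in [C_+], [W] in
   [C_-]), and [D J = 0] says that these commute with [J] in the variable [W].
   If [N_J] and [N_J'] vanish, [J' = G J] being [J] on [C_+] and [- J] on [C_-],
   this commutation is a projection of the equation [N_J + N_J' = 0].

   If [D J = 0], the terms involving [D] cancel in the (3,0) + (0,3) component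
   of the torsion, and what remains is [<N_J (a, b), c>].  As [G] is positive
   definite, the type condition thus amounts to [N_J = 0].  Finally [D J = 0]
   and [N_J = 0] imply [N_J' = 0]: the mixed components of [N_J'] are expressed
   by [D], and on [C_+] one uses
   [<[J a, J b], c> = <J b, [c, J a]> = <J b, J [c, a]> = <[a, b], c>] for [c]
   in [C_-].

   The Courant axioms only hold for smooth sections, so [P], [Q] and [C] have
   to be shown smooth: in local frames their values are solutions of linear
   systems with smooth coefficients. *)

From HB Require Import structures.
From mathcomp Require Import all_boot all_order all_algebra sesquilinear.
From mathcomp Require Import all_classical all_reals all_analysis.
From mathcomp Require Import complex ring lra.
Require Import Defs.

Set Implicit Arguments.
Unset Strict Implicit.
Unset Printing Implicit Defensive.

Import Order.TTheory GRing.Theory Num.Theory.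
Import numFieldNormedType.Exports.

Local Open Scope classical_set_scope.
Local Open Scope ring_scope.

(** * Functions of class C^k *)

Section Ck.
Variables (R : realType) (V W : normedModType R).
Implicit Types (f g : V -> W) (A : set V) (x v : V) (k : nat).

(** The expansion [f (x + h) = f x + 'd f x h + o(h)] only sees the germ of [f] at [x], so it is
    also an expansion of [g], and differentials are unique. *)
Lemma near_eq_diff f g x :
  {near x, f =1 g} -> differentiable f x ->
  differentiable g x /\ 'd g x = 'd f x :> (V -> W).
Proof.
move=> fg /diff_locallyP[cdf /eqaddoP Hf].
have gx : f x = g x by have := nbhs_singleton fg.
have Hg : g \o shift x = cst (g x) + 'd f x +o_ 0 id.
  apply/eqaddoP => e e0; rewrite -gx.
  have nfg : \forall h \near 0, f (h + x) = g (h + x).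
    by move: fg; rewrite (near_shift 0 x) /= subr0.
  apply: filterS2 nfg (Hf e e0) => h fgh.
  by rewrite !fctE /= fgh.
have dg := diff_unique cdf Hg.
split; last exact: dg.
by apply/diff_locallyP; rewrite dg.
Qed.

(** Openness of [A] turns equality on [A] into equality of germs at its points, which passes to the
    derivatives. *)
Lemma eq_Ck k A f g : open A -> (forall x, A x -> f x = g x) ->
  Ck k A f -> Ck k A g.
Proof.
move=> oA; have nearA x : A x -> {near x, forall y, A y}.
  by move=> Ax; apply: open_nbhs_nbhs; split.
elim: k f g => [|k IH] f g fg /=.
  move=> cf x Ax; rewrite /prop_for /continuous_at -(fg _ Ax).
  apply: cvg_trans (cf x Ax); apply: near_eq_cvg.
  by apply: filterS (nearA _ Ax) => y Ay; rewrite fg.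
have nfg x : A x -> {near x, f =1 g}.
  by move=> Ax; apply: filterS (nearA _ Ax) => y Ay; rewrite fg.
move=> [df ddf]; split=> [x Ax|v].
  by have [] := near_eq_diff (nfg _ Ax) (df _ Ax).
apply: IH (ddf v) => x Ax.
by have [_ ->] := near_eq_diff (nfg _ Ax) (df _ Ax).
Qed.

Lemma CkW k A f : Ck k.+1 A f -> Ck k A f.
Proof.
elim: k f => [|k IH] f [df ddf].
  by move=> x Ax; exact/differentiable_continuous/df.
split=> [x Ax|v]; first exact: df.
by apply: IH; exact: ddf.
Qed.

(** [Ck] unfolds to conditions at single points of [A], so the sets [B] may vary with the point and
    need not be neighbourhoods of it. *)
Lemma Ck_pointwise k A f :
  (forall x, A x -> exists2 B : set V, B x & Ck k B f) -> Ck k A f.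
Proof.
elim: k f => [|k IH] f H /=.
  by move=> x /H[B Bx]; exact.
split=> [x /H[B Bx [+ _]]|v]; first exact.
by apply: IH => x /H[B Bx [_ ddf]]; exists B; last exact: ddf.
Qed.

Lemma sub_Ck k A (B : set V) f : A `<=` B -> Ck k B f -> Ck k A f.
Proof. by move=> AB CB; apply: Ck_pointwise => x /AB Bx; exists B. Qed.

Lemma Ck_cst k A (a : W) : Ck k A (fun=> a).
Proof.
elim: k a => [|k IH] a /=; first by move=> x _; exact: cst_continuous.
split=> [x _|v]; first exact: differentiable_cst.
suff -> : (fun x : V => 'd (fun=> a : W) x v) = fun=> 0 by [].
by apply/funext => x; rewrite (diff_cst a x).
Qed.

(** Model of the closure proofs: the formula for the derivative holds only on [A], so [eq_Ck] is
    what carries the induction hypothesis over to it. *)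
Lemma CkD k A f g : open A -> Ck k A f -> Ck k A g ->
  Ck k A (fun x => f x + g x).
Proof.
move=> oA; elim: k f g => [|k IH] f g /=.
  by move=> cf cg x Ax; apply: cvgD; [exact: cf|exact: cg].
move=> [df ddf] [dg ddg]; split=> [x Ax|v].
  by apply: (@differentiableD _ _ _ f g); [exact: df|exact: dg].
apply: eq_Ck (IH _ _ (ddf v) (ddg v)) => // x Ax.
by rewrite (@diffD _ _ _ f g) //; [exact: df|exact: dg].
Qed.

End Ck.

Lemma Ck_lin (R : realType) (V W W' : normedModType R) k (A : set V)
    (f : V -> W) (l : {linear W -> W'}) :
  continuous l -> open A -> Ck k A f -> Ck k A (l \o f).
Proof.
move=> cl oA; elim: k f => [|k IH] f /=.
  by move=> cf x Ax; apply: continuous_comp; [exact: cf|exact: cl].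
have dl y : differentiable l y by exact: linear_differentiable.
move=> [df ddf]; split=> [x Ax|v].
  by apply: differentiable_comp => //; exact: df.
refine (eq_Ck oA _ (IH _ (ddf v))) => x Ax.
by rewrite diff_comp //= ?diff_lin //; exact: df.
Qed.

Section CkScalar.
Variables (R : realType) (V : normedModType R).
Implicit Types (f g : V -> R^o) (A : set V) (k : nat).

Lemma CkM k A f g : open A -> Ck k A f -> Ck k A g ->
  Ck k A (fun x => f x * g x : R^o).
Proof.
move=> oA; elim: k f g => [|k IH] f g.
  by move=> cf cg x Ax; apply: cvgM; [exact: cf|exact: cg].
move=> Cf Cg; have := (Cf, Cg) => -[[df ddf] [dg ddg]]; split=> [x Ax|v].
  by apply: (@differentiableM _ _ f g); [exact: df|exact: dg].
have := CkD oA (IH _ _ (CkW Cf) (ddg v)) (IH _ _ (CkW Cg) (ddf v)).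
apply: eq_Ck => // x Ax.
by rewrite (@diffM _ _ f g) //; [exact: df|exact: dg].
Qed.

Lemma CkV k A f : open A -> (forall x, A x -> f x != 0) ->
  Ck k A f -> Ck k A (fun x => (f x)^-1 : R^o).
Proof.
move=> oA f0; elim: k f f0 => [|k IH] f f0.
  by move=> cf x Ax; apply: cvgV; [exact: f0|exact: cf].
move=> Cf; have := Cf => -[df ddf]; split=> [x Ax|v].
  by apply: (@differentiableV _ _ f); [exact: df|exact: f0].
have CV := IH f f0 (CkW Cf).
(* The derivative of [1 / f] is [- f^-1 f^-1 'd f], where [f^-1] is C^k by induction. *)
have := CkM oA (CkM oA (Ck_cst k A (-1 : R^o)) (CkM oA CV CV)) (ddf v).
apply: eq_Ck => // x Ax.
rewrite (@diffV _ _ f) //=; [|exact: df|exact: f0].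
by rewrite mulN1r -invfM -expr2.
Qed.

End CkScalar.

(** * Smooth functions and matrices on a manifold *)

Lemma row_mul_tr_eq0 (R : realDomainType) m (u : 'rV[R]_m) :
  u *m u^T = 0 -> u = 0.
Proof.
move=> /(congr1 (fun B : 'M[R]_1 => B 0 0)) /eqP.
rewrite !mxE psumr_eq0 => [/allP u0|j _]; last by rewrite mxE -expr2 sqr_ge0.
apply/rowP => j; rewrite mxE; apply/eqP.
by have := u0 j (mem_index_enum _); rewrite mxE -expr2 sqrf_eq0.
Qed.

Section SmoothMaps.
Variables (R : realType) (n : nat) (M : manifold R n).
Implicit Types (U : set M) (i : atlas M).

(** Points near [coord i x] lie in the chart image, which is open, and [param i], being continuous
    there, sends them into [U]. *)
Lemma coord_image_open U i : open U -> open (coord i @` (U `&` dom i)).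
Proof.
move=> oU; rewrite openE => _ [x [Ux dx] <-].
have nearU : \forall y \near coord i x, (U `&` dom i) (param i y).
  apply: (param_continuous dx); rewrite (coordK dx).
  apply: open_nbhs_nbhs; split; last by [].
  by apply: openI => //; exact: dom_open.
have neard : \forall y \near coord i x, (coord i @` dom i) y.
  by apply: open_nbhs_nbhs; split; [exact: coord_open|exists x].
apply: filterS2 nearU neard => y Uy [z dz zy].
by move: Uy; rewrite -zy (coordK dz) => Uz; exists z.
Qed.

Section Generic.
Variable W : normedModType R.
Implicit Types f g : M -> W.

Lemma eq_smooth_map_on U f g : open U -> (forall x, U x -> f x = g x) ->
  smooth_map_on U f -> smooth_map_on U g.
Proof.
move=> oU fg sf i k; apply: eq_Ck (sf i k); first exact: coord_image_open.
by move=> _ [x [Ux dx] <-] /=; rewrite (coordK dx) fg.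
Qed.

Lemma sub_smooth_map_on U U' f : U `<=` U' ->
  smooth_map_on U' f -> smooth_map_on U f.
Proof.
move=> UU' sf i k; apply: sub_Ck (sf i k).
by move=> _ [x [Ux dx] <-]; exists x => //; split=> //; exact: UU'.
Qed.

Lemma smooth_map_on_local U f :
  (forall x, U x -> exists2 U', U' x & smooth_map_on U' f) ->
  smooth_map_on U f.
Proof.
move=> H i k; apply: Ck_pointwise => _ [x [Ux dx] <-].
by have [U' U'x sf] := H x Ux; exists (coord i @` (U' `&` dom i));
  [exists x|exact: sf].
Qed.

Lemma smooth_map_on_cst U (a : W) : smooth_map_on U (fun=> a).
Proof. by move=> i k; exact: Ck_cst. Qed.

Lemma smooth_map_onD U f g : open U -> smooth_map_on U f ->
  smooth_map_on U g -> smooth_map_on U (fun x => f x + g x).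
Proof.
move=> oU sf sg i k.
exact (CkD (coord_image_open oU) (sf i k) (sg i k)).
Qed.

Lemma smooth_map_on_sum U (I : finType) (P : pred I) (f : I -> M -> W) :
  open U -> (forall j, P j -> smooth_map_on U (f j)) ->
  smooth_map_on U (fun x => \sum_(j | P j) f j x).
Proof.
move=> oU sf.
suff H (s : seq I) : smooth_map_on U (fun x => \sum_(j <- s | P j) f j x).
  exact: H.
elim: s => [|j s IH].
  apply: eq_smooth_map_on (smooth_map_on_cst U 0) => // x _.
  by rewrite big_nil.
case: (boolP (P j)) => Pj.
  apply: eq_smooth_map_on (smooth_map_onD oU (sf j Pj) IH) => // x _.
  by rewrite big_cons Pj.
by apply: eq_smooth_map_on IH => // x _; rewrite big_cons (negbTE Pj).
Qed.

End Generic.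

Lemma smooth_map_on_lin (W W' : normedModType R) (l : {linear W -> W'}) U
  (f : M -> W) : continuous l -> open U -> smooth_map_on U f ->
  smooth_map_on U (fun x => l (f x)).
Proof.
move=> cl oU sf i k.
exact (Ck_lin cl (coord_image_open oU) (sf i k)).
Qed.

Section Scalar.
Implicit Types f g : M -> R^o.

Lemma smooth_map_onM U f g : open U -> smooth_map_on U f ->
  smooth_map_on U g -> smooth_map_on U (fun x => f x * g x : R^o).
Proof.
move=> oU sf sg i k.
exact (CkM (coord_image_open oU) (sf i k) (sg i k)).
Qed.

Lemma smooth_map_on_prod U (I : finType) (P : pred I) (f : I -> M -> R^o) :
  open U -> (forall j, P j -> smooth_map_on U (f j)) ->
  smooth_map_on U (fun x => \prod_(j | P j) (f j x : R) : R^o).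
Proof.
move=> oU sf.
suff H (s : seq I) :
    smooth_map_on U (fun x => \prod_(j <- s | P j) (f j x : R) : R^o).
  exact: H.
elim: s => [|j s IH].
  apply: eq_smooth_map_on (smooth_map_on_cst U (1 : R^o)) => // x _.
  by rewrite big_nil.
case: (boolP (P j)) => Pj.
  apply: eq_smooth_map_on (smooth_map_onM oU (sf j Pj) IH) => // x _.
  by rewrite big_cons Pj.
by apply: eq_smooth_map_on IH => // x _; rewrite big_cons (negbTE Pj).
Qed.

Lemma smooth_map_onV U f : open U -> (forall x, U x -> f x != 0) ->
  smooth_map_on U f -> smooth_map_on U (fun x => (f x)^-1 : R^o).
Proof.
move=> oU f0 sf i k.
apply: CkV (sf i k); first exact: coord_image_open.
by move=> _ [x [Ux dx] <-] /=; rewrite (coordK dx) f0.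
Qed.

(** Both directions compose with continuous linear maps: the coordinate functionals, and
    [t |-> t *: w] for the standard row vectors [w]. *)
Lemma smooth_map_on_row m U (f : M -> 'rV[R]_m) : open U ->
  smooth_map_on U f <->
  forall j, smooth_map_on U (fun x => f x 0 j : R^o).
Proof.
move=> oU; split=> [sf j|sf].
  have l_linear : linear (fun v : 'rV[R]_m => v 0 j : R^o).
    by move=> a u v; rewrite !mxE.
  pose lM := GRing.isLinear.Build _ _ _ _ _ l_linear.
  pose l : {linear 'rV[R]_m -> R^o} := HB.pack (fun v : 'rV[R]_m => v 0 j : R^o) lM.
  by apply: (smooth_map_on_lin (l := l)) => //; exact: matrix_normedtype.coord_continuous.
have H j : smooth_map_on U (fun x => f x 0 j *: (delta_mx 0 j : 'rV[R]_m)).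
  pose w : 'rV[R]_m := delta_mx 0 j.
  have l_linear : linear (fun t : R^o => t *: w).
    by move=> a u v; rewrite scalerDl scalerA.
  pose lM := GRing.isLinear.Build _ _ _ _ _ l_linear.
  pose l : {linear R^o -> 'rV[R]_m} := HB.pack (fun t : R^o => t *: w) lM.
  apply: (smooth_map_on_lin (l := l) _ oU (sf j)).
  exact: scalel_continuous.
apply: eq_smooth_map_on (smooth_map_on_sum oU (fun j (_ : xpredT j) => H j)) => //.
by move=> x _; rewrite -row_sum_delta.
Qed.

End Scalar.

Definition smooth_mx_on U m p (A : M -> 'M[R]_(m, p)) :=
  forall (i : 'I_m) (j : 'I_p), smooth_map_on U (fun x => A x i j : R^o).

Lemma smooth_mx_onM U m p q (A : M -> 'M[R]_(m, p)) (B : M -> 'M[R]_(p, q)) :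
  open U -> smooth_mx_on U A -> smooth_mx_on U B ->
  smooth_mx_on U (fun x => A x *m B x).
Proof.
move=> oU sA sB i j.
apply: eq_smooth_map_on (smooth_map_on_sum oU
  (fun k (_ : xpredT k) => smooth_map_onM oU (sA i k) (sB k j))) => // x _.
by rewrite mxE.
Qed.

Lemma smooth_det U m (A : M -> 'M[R]_m) : open U -> smooth_mx_on U A ->
  smooth_map_on U (fun x => \det (A x) : R^o).
Proof.
move=> oU sA; apply: smooth_map_on_sum => // s _.
apply: smooth_map_onM => //; first exact: smooth_map_on_cst.
exact: smooth_map_on_prod.
Qed.

(** Cramer's rule: the entries are cofactors, polynomial in the entries of [A], divided by the
    nonvanishing determinant. *)
Lemma smooth_invmx U m (A : M -> 'M[R]_m) : open U -> smooth_mx_on U A ->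
  (forall x, U x -> A x \in unitmx) -> smooth_mx_on U (fun x => invmx (A x)).
Proof.
move=> oU sA uA i j.
have sV : smooth_map_on U (fun x => (\det (A x))^-1 : R^o).
  apply: smooth_map_onV => //; last exact: smooth_det.
  by move=> x /uA; rewrite unitmxE unitfE.
have sC : smooth_map_on U (fun x => cofactor (A x) j i : R^o).
  apply: smooth_map_onM => //; first exact: smooth_map_on_cst.
  apply: smooth_det => // a b.
  by apply: eq_smooth_map_on (sA (lift j a) (lift i b)) => // x _; rewrite !mxE.
apply: eq_smooth_map_on (smooth_map_onM oU sV sC) => // x Ux.
by rewrite /invmx (uA x Ux) !mxE.
Qed.

(* A row-free real matrix [A] has the smooth right inverse
   [A^T (A A^T)^-1]. *)
Lemma smooth_solution U m p (A : M -> 'M[R]_(m, p)) (w : M -> 'rV[R]_p)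
    (c : M -> 'rV[R]_m) : open U -> smooth_mx_on U A -> smooth_mx_on U w ->
  (forall x, U x -> row_free (A x)) ->
  (forall x, U x -> c x *m A x = w x) -> smooth_mx_on U c.
Proof.
move=> oU sA sw fA cA.
have sT : smooth_mx_on U (fun x => (A x)^T).
  move=> i j; apply: eq_smooth_map_on (sA j i) => // x _; by rewrite mxE.
(* If [v A A^T = 0], then [v A] has zero dot product with itself, hence vanishes. *)
have uA x : U x -> A x *m (A x)^T \in unitmx.
  move=> Ux; rewrite -row_free_unit -kermx_eq0 -submx0; apply/row_subP => i.
  set v := row i _.
  have : v *m (A x *m (A x)^T) = 0.
    by apply/sub_kermxP; exact: row_sub.
  move=> /(congr1 (mulmx^~ v^T)); rewrite mul0mx mulmxA -mulmxA -trmx_mul.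
  move=> /row_mul_tr_eq0 u0.
  have -> : v = 0 by apply: (row_free_inj (fA x Ux)); rewrite u0 mul0mx.
  exact: sub0mx.
have := smooth_mx_onM oU (smooth_mx_onM oU sw sT)
  (smooth_invmx oU (smooth_mx_onM oU sA sT) uA).
move=> s i j; apply: eq_smooth_map_on (s i j) => // x Ux.
by rewrite -(cA x Ux) -[_ *m A x *m _]mulmxA mulmxK ?uA.
Qed.

End SmoothMaps.

(** * Linear algebra of a generalized metric *)

Lemma scaler_half_add (R : numFieldType) (V : lmodType R) (v : V) :
  2^-1 *: (v + v) = v.
Proof. by rewrite scalerDr -scalerDl -[RHS]scale1r; congr (_ *: _); field. Qed.

Section SymmetricForm.
Variables (R : realType) (V : vectType R) (B : {symmetric V}).
Implicit Types (u v w : V) (U : {vspace V}).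

Lemma formC u v : B u v = B v u.
Proof. by rewrite hermC expr0 mul1r. Qed.

Lemma formDl u v w : B (u + v) w = B u w + B v w.
Proof. exact: linearDl. Qed.

Lemma formDr u v w : B w (u + v) = B w u + B w v.
Proof. exact: linearDr. Qed.

Lemma formNl u w : B (- u) w = - B u w.
Proof. exact: linearNl. Qed.

Lemma formNr u w : B w (- u) = - B w u.
Proof. exact: linearNr. Qed.

Lemma formBl u v w : B (u - v) w = B u w - B v w.
Proof. exact: linearBl. Qed.

Lemma formBr u v w : B w (u - v) = B w u - B w v.
Proof. exact: linearBr. Qed.

Lemma formZl k u w : B (k *: u) w = k * B u w.
Proof. exact: linearZl_LR. Qed.

Lemma formZr k u w : B w (k *: u) = k * B w u.
Proof. exact: linearZr_LR. Qed.

Lemma form0l w : B 0 w = 0.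
Proof. exact: linear0l. Qed.

Lemma form0r w : B w 0 = 0.
Proof. exact: linear0r. Qed.

Lemma form_sumr (I : finType) (v : I -> V) w :
  B w (\sum_i v i) = \sum_i B w (v i).
Proof. exact: linear_sumr. Qed.

Lemma form_suml (I : finType) (v : I -> V) w :
  B (\sum_i v i) w = \sum_i B (v i) w.
Proof. by rewrite formC form_sumr; apply: eq_bigr => i _; exact: formC. Qed.

Lemma form0_nondegenerate u :
  nondegenerate B -> (forall v, B u v = 0) -> u = 0.
Proof.
move=> /eqP rad0 Bu0; apply/eqP; rewrite -memv0 -rad0.
by apply/mem_orthovP => v _; exact: Bu0.
Qed.

Lemma positive_definite_cap_orthov U :
  positive_definite B U -> (U :&: orthov B U = 0)%VS.
Proof.
move=> pU; apply/eqP; rewrite -subv0; apply/subvP => u.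
rewrite memv_cap memv0 => /andP[Uu /mem_orthovP/(_ _ Uu) Buu].
by apply: contraT => u0; have := pU u Uu u0; rewrite Buu ltxx.
Qed.

(** Dimension count: the orthogonal of [U] is the kernel of the map to [R^(dim U)] that pairs with a
    basis of [U], so its codimension is at most [dim U]. *)
Lemma positive_definite_add_orthov U :
  positive_definite B U -> (U + orthov B U = fullv)%VS.
Proof.
move=> pU; apply/eqP; rewrite eqEdim subvf /=.
rewrite dimv_disjoint_sum ?positive_definite_cap_orthov //.
pose f v : 'rV[R]_(\dim U) := \row_i B v (vbasis U)`_i.
have f_linear : linear f.
  by move=> a u v; apply/rowP => i; rewrite !mxE linearPl.
pose fM := GRing.isLinear.Build _ _ _ _ _ f_linear.
pose fL : {linear V -> 'rV[R]_(\dim U)} := HB.pack f fM.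
have kerE : lker (linfun fL) = orthov B U.
  apply/vspaceP => v; rewrite memv_ker lfunE /=; apply/eqP/mem_orthovP.
    move=> fv0 u /coord_vbasis ->; rewrite linear_sumr big1 // => i _.
    rewrite linearZr /=; have := congr1 (fun w : 'rV_ _ => w 0 i) fv0.
    by rewrite !mxE => ->; rewrite mulr0.
  move=> Bv; apply/rowP => i; rewrite !mxE Bv //.
  by rewrite vbasis_mem // mem_nth // size_tuple.
have := limg_ker_dim (linfun fL) fullv.
rewrite capfv kerE => <-; rewrite addnC leq_add2r.
by apply: leq_trans (dimvS (subvf _)) _; rewrite dimvf /dim /= mul1n.
Qed.

End SymmetricForm.

(** * The splitting of one fibre by a maximal positive-definite subspace *)

Section Splitting.
Variables (R : realType) (V : vectType R) (B : {symmetric V}).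
Variable Cp : {vspace V}.
Hypothesis Bnondeg : nondegenerate B.
Hypothesis Cp_pos : positive_definite B Cp.
Hypothesis Cp_max : forall U : {vspace V},
  positive_definite B U -> (Cp <= U)%VS -> U = Cp.

Local Notation P := (proj_plus B Cp).
Local Notation Q := (proj_minus B Cp).
Local Notation Gm := (metric_endo B Cp).
Local Notation Gf := (metric_form B Cp).
Local Notation Cm := (orthov B Cp).
Implicit Types (u v w : V).

Let cap0 : (Cp :&: Cm = 0)%VS := positive_definite_cap_orthov Cp_pos.
Let cap0' : (Cm :&: Cp = 0)%VS. Proof. by rewrite capvC. Qed.

Lemma proj_plus_mem u : P u \in Cp.
Proof. exact: memv_pi. Qed.

Lemma proj_minus_mem u : Q u \in Cm.
Proof. exact: memv_pi. Qed.

Lemma proj_add u : P u + Q u = u.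
Proof.
by apply: daddv_pi_add => //; rewrite positive_definite_add_orthov ?memvf.
Qed.

Lemma proj_plus_id u : u \in Cp -> P u = u.
Proof. exact: daddv_pi_id. Qed.

Lemma proj_minus_id u : u \in Cm -> Q u = u.
Proof. exact: daddv_pi_id. Qed.

Lemma proj_plusK u : P (P u) = P u.
Proof. by rewrite proj_plus_id ?proj_plus_mem. Qed.

Lemma proj_minusK u : Q (Q u) = Q u.
Proof. by rewrite proj_minus_id ?proj_minus_mem. Qed.

Lemma proj_minus_plus u : Q (P u) = 0.
Proof. by apply: (addrI (P (P u))); rewrite proj_add addr0 proj_plusK. Qed.

Lemma proj_plus_minus u : P (Q u) = 0.
Proof. by apply: (addIr (Q (Q u))); rewrite proj_add add0r proj_minusK. Qed.

Lemma form_plus_minus u v : B (P u) (Q v) = 0.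
Proof. by rewrite formC; have /mem_orthovP := proj_minus_mem v; apply; exact: proj_plus_mem. Qed.

Lemma form_minus_plus u v : B (Q u) (P v) = 0.
Proof. by rewrite formC form_plus_minus. Qed.

Lemma form_plusl u v : B (P u) v = B u (P v).
Proof.
by rewrite -{1}(proj_add v) -{2}(proj_add u) formDr formDl
  form_plus_minus form_minus_plus !addr0.
Qed.

Lemma form_minusl u v : B (Q u) v = B u (Q v).
Proof.
by rewrite -{1}(proj_add v) -{2}(proj_add u) formDr formDl
  form_plus_minus form_minus_plus !add0r.
Qed.

(** A vector of [Cm] with positive square could be added to [Cp], against maximality, so [B] is
    nonpositive on [Cm]. A null vector of a semidefinite form is orthogonal to all of [Cm], hence to
    [V], and nondegeneracy makes it zero. *)
Lemma orthov_negative_definite : negative_definite B Cm.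
Proof.
have le0 u : u \in Cm -> B u u <= 0.
  move=> uCm; rewrite leNgt; apply/negP => Buu.
  have Cu0 w : w \in Cp -> B w u = 0 by move=> Cw; rewrite formC (mem_orthovP uCm).
  have pos : positive_definite B (Cp + <[u]>)%VS.
    move=> _ /memv_addP[w Cw [_ /vlineP[k ->] ->]] nz.
    rewrite formDr !formDl !formZr !formZl Cu0 // formC Cu0 //.
    rewrite !mulr0 addr0 add0r mulrA -expr2.
    have [w0|w0] := eqVneq w 0.
      rewrite w0 form0r add0r mulr_gt0 // exprn_even_gt0 //=.
      by apply: contraNneq nz => k0; rewrite w0 k0 scale0r addr0.
    by apply: ltr_wpDr; [rewrite mulr_ge0 ?sqr_ge0 // ltW|exact: Cp_pos].
  have /Cp_max H := pos; have uCp : u \in Cp.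
    by rewrite -(H (addvSl _ _)) (subvP (addvSr _ _)) ?memv_line.
  by move: Buu; rewrite Cu0 // ltxx.
move=> u uCm u0; rewrite lt_neqAle le0 // andbT; apply: contraNneq u0 => Buu.
apply/eqP/(form0_nondegenerate Bnondeg) => v.
rewrite -(proj_add v) formDr (mem_orthovP uCm) ?proj_plus_mem // add0r.
set w := Q v; have wCm : w \in Cm by exact: proj_minus_mem.
(* [B (w + t u) (w + t u) = B w w + 2 t B u w] is nonpositive for all [t] *)
apply/eqP/negPn/negP => Buw.
have := le0 (w + ((1 - B w w) / (2 * B u w)) *: u).
rewrite memvD ?memvZ // => /(_ isT).
rewrite formDr !formDl !formZr !formZl Buu !mulr0 addr0 (formC B w u).
have -> : B w w + (1 - B w w) / (2 * B u w) * B u w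
    + (1 - B w w) / (2 * B u w) * B u w = 1 by field.
by rewrite ler10.
Qed.

Lemma metric_endoE u : Gm u = P u - Q u.
Proof. by rewrite add_lfunE opp_lfunE. Qed.

Lemma metric_formE u v : Gf u v = B (Gm u) v.
Proof.
by rewrite metric_endoE formBl /metric_form -!form_plusl -!form_minusl
  proj_plusK proj_minusK.
Qed.

Lemma metric_endoK u : Gm (Gm u) = u.
Proof.
rewrite !metric_endoE !linearB /= proj_plusK proj_minusK proj_plus_minus.
by rewrite proj_minus_plus oppr0 addr0 add0r opprK proj_add.
Qed.

Lemma metric_form_gt0 u : u != 0 -> 0 < Gf u u.
Proof.
move=> u0; rewrite /metric_form.
have Pge : 0 <= B (P u) (P u).
  have [->|Pu] := eqVneq (P u) 0; first by rewrite form0r.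
  by rewrite ltW // Cp_pos ?proj_plus_mem.
have [Q0|Qu] := eqVneq (Q u) 0.
  rewrite Q0 form0r subr0 Cp_pos ?proj_plus_mem //.
  by apply: contraNneq u0 => P0; rewrite -(proj_add u) P0 Q0 addr0.
by rewrite ltr_wpDl // oppr_gt0 orthov_negative_definite ?proj_minus_mem.
Qed.

(** As [Gf] is positive definite on all of [V], even a subspace isotropic for [B] has its
    [Gf]-orthogonal as a complement. This yields the splitting of [E] into [T] and [T^*]. *)
Lemma orthov_metric_form_add (K : {vspace V}) :
  (K :&: orthov Gf K = 0)%VS /\ (K + orthov Gf K = fullv)%VS.
Proof.
have pK : positive_definite Gf K by move=> u _; exact: metric_form_gt0.
split; first exact: positive_definite_cap_orthov.
exact: positive_definite_add_orthov.
Qed.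

(** * The splitting given by a Lagrangian subspace [K], which stands for the fibre of [T^*] *)

Section Lagrangian.
Variable K : {vspace V}.
Hypothesis K_lagrangian : forall u, (u \in K) <-> forall k, k \in K -> B k u = 0.
Local Notation T := (orthov Gf K).
Local Notation C := (daddv_pi T K - daddv_pi K T).

Let capKT : (K :&: T = 0)%VS. Proof. by have [] := orthov_metric_form_add K. Qed.
Let capTK : (T :&: K = 0)%VS. Proof. by rewrite capvC. Qed.

(** With the next lemma: [Gm] exchanges [T] and [K], because [Gf u k = B (Gm u) k] and [K] is its
    own orthogonal for [B]. *)
Lemma metric_endo_orthov u : u \in T -> Gm u \in K.
Proof.
move=> /mem_orthovP uT; apply/K_lagrangian => k Kk.
by rewrite formC -metric_formE uT.
Qed.

Lemma metric_endo_lagrangian u : u \in K -> Gm u \in T.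
Proof.
move=> uK; apply/mem_orthovP => k Kk.
rewrite -[LHS]/(Gf (Gm u) k) metric_formE metric_endoK formC.
by move/K_lagrangian : uK; apply.
Qed.

Lemma lagrangian_split u : exists t k, [/\ t \in T, k \in K & u = t + k].
Proof.
have [_ full] := orthov_metric_form_add K.
have /memv_addP[k Kk [t Tt ->]] : u \in (K + T)%VS by rewrite full memvf.
by exists t, k; rewrite addrC.
Qed.

Lemma involutionE t k : t \in T -> k \in K -> C (t + k) = t - k.
Proof.
move=> Tt Kk; rewrite add_lfunE opp_lfunE !linearD /=.
have pi0 (U W : {vspace V}) w : (U :&: W = 0)%VS -> w \in W -> daddv_pi U W w = 0.
  move=> UW Ww; have WU : (W :&: U = 0)%VS by rewrite capvC.
  have := daddv_pi_add UW (subvP (addvSr U W) _ Ww).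
  by rewrite (daddv_pi_id WU Ww) -[RHS]add0r => /addIr.
rewrite (daddv_pi_id capTK Tt) (daddv_pi_id capKT Kk).
by rewrite (pi0 _ _ _ capTK Kk) (pi0 _ _ _ capKT Tt) !(addr0, add0r, oppr0).
Qed.

(** The difference is [- 2 k] for [u = t + k]. When [K] is the kernel of the anchor, this says that
    [C] preserves anchors. *)
Lemma involution_sub_mem u : C u - u \in K.
Proof.
have [t [k [Tt Kk ->]]] := lagrangian_split u; rewrite involutionE //.
rewrite opprD addrACA subrr add0r -opprD memvN memvD //.
Qed.

(** [C] is [1] on [T] and [-1] on [K], and [Gm] exchanges the two. This is why [C] exchanges the
    eigenspaces [Cp] and [Cm] of [Gm]. *)
Lemma involution_anticomm u : C (Gm u) = - Gm (C u).
Proof.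
have [t [k [Tt Kk ->]]] := lagrangian_split u; rewrite involutionE //.
rewrite [Gm (t + k)]linearD [Gm t + _]addrC /=.
rewrite (involutionE (metric_endo_lagrangian Kk) (metric_endo_orthov Tt)).
by rewrite [Gm (t - k)]linearB opprB.
Qed.

Lemma proj_plus_metric u : P u = 2^-1 *: (u + Gm u).
Proof.
rewrite -{2}(proj_add u) metric_endoE addrACA subrr addr0.
by rewrite scaler_half_add.
Qed.

Lemma proj_minus_metric u : Q u = 2^-1 *: (u - Gm u).
Proof.
rewrite -{2}(proj_add u) metric_endoE opprB addrCA -addrA subrKC.
by rewrite scaler_half_add.
Qed.

Lemma involution_minus u : C (Q u) = P (C u).
Proof.
rewrite proj_minus_metric proj_plus_metric linearZ linearB /=.
by rewrite [X in _ - X]involution_anticomm opprK.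
Qed.

Lemma involution_plus u : C (P u) = Q (C u).
Proof.
rewrite proj_minus_metric proj_plus_metric linearZ linearD /=.
by rewrite [X in _ + X]involution_anticomm.
Qed.

(** The isotropic [K] meets the definite subspaces [Cp] and [Cm] only in zero. When [K] is the
    kernel of the anchor, a vector is thus determined by the anchors of its two projections. *)
Lemma lagrangian_proj_inj u : P u \in K -> Q u \in K -> u = 0.
Proof.
move=> Pu Qu; have [Bp Bq] : B (P u) (P u) = 0 /\ B (Q u) (Q u) = 0.
  by split; [move/K_lagrangian : (Pu)|move/K_lagrangian : (Qu)]; apply.
have Pu0 : P u = 0.
  by apply/eqP; apply: contraT => /(Cp_pos (proj_plus_mem u)); rewrite Bp ltxx.
have Qu0 : Q u = 0.
  apply/eqP; apply: contraT => /(orthov_negative_definite (proj_minus_mem u)).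
  by rewrite Bq ltxx.
by rewrite -(proj_add u) Pu0 Qu0 addr0.
Qed.

End Lagrangian.
End Splitting.

(** * Smooth sections and smoothness of the splitting *)

Lemma mulmx_inj_row_free (F : fieldType) m p (A : 'M[F]_(m, p)) :
  (forall v : 'rV_m, v *m A = 0 -> v = 0) -> row_free A.
Proof.
move=> A0; rewrite -kermx_eq0 -submx0; apply/row_subP => i.
by rewrite (A0 (row i _)) ?sub0mx //; apply/sub_kermxP; exact: row_sub.
Qed.

Section Components.
Variables (R : realType) (n : nat) (M : manifold R n).

(** [psi] inverts the transition map [phi] near [p], so by the chain rule the differential of [phi]
    has a left inverse. *)
Lemma components_inj (i : atlas M) (x : M) (v : tangent x) :
  dom i x -> components i v = 0 -> v = 0.
Proof.
move=> ix; rewrite /components.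
set c := chart_at x; set p := coord c x.
have cx : dom c x by exact: mem_chart_at.
pose phi := coord i \o param c; pose psi := coord c \o param i.
have dphi : differentiable phi p.
  by have [+ _] := @transition_smooth _ _ M c i 1%N; apply; exists x.
have phip : phi p = coord i x by rewrite /phi /= /p coordK.
have dpsi : differentiable psi (phi p).
  rewrite phip; have [+ _] := @transition_smooth _ _ M i c 1%N.
  by apply; exists x.
have near_id : {near p, id =1 psi \o phi}.
  have : \forall y \near p, (coord c @` (dom i `&` dom c)) y.
    apply: open_nbhs_nbhs; split; last by exists x.
    by apply: coord_image_open; exact: dom_open.
  apply: filterS => _ [y [iy cy] <-].
  by rewrite /psi /phi /= (coordK cy) (coordK iy).
have [_ d_id] := near_eq_diff near_id (@ex_diff _ _ _ _ _ _ _ (is_diff_id p)).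
have d_comp : 'd (psi \o phi) p v = 'd psi (phi p) ('d phi p v).
  exact (congr1 (fun f => f v) (diff_comp dphi dpsi)).
have d_idv : 'd (psi \o phi) p v = v.
  rewrite d_id.
  exact (congr1 (fun f => f v) (@diff_val _ _ _ _ _ _ _ (is_diff_id p))).
move=> dv0; have dphi0 : 'd phi p v = 0 := dv0.
exact (etrans (etrans (esym d_idv) d_comp)
  (etrans (congr1 ('d psi (phi p)) dphi0) (linear0 ('d psi (phi p))))).
Qed.

Lemma components_sum (i : atlas M) (x : M) (I : finType) (v : I -> tangent x)
    (a : I -> R) :
  components i (\sum_j a j *: v j) = \sum_j a j *: components i (v j).
Proof.
rewrite /components linear_sum; apply: eq_bigr => j _.
by rewrite linearZ.
Qed.

End Components.

Section SmoothSections.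
Variables (R : realType) (n : nat) (M : manifold R n) (E : vector_bundle M).
Implicit Types (U : set M) (s : bsection E) (i : triv_index E) (x : M).

Lemma sub_smooth_section_on U U' s : U `<=` U' ->
  smooth_section_on U' s -> smooth_section_on U s.
Proof.
move=> UU' ss i; apply: sub_smooth_map_on (ss i) => x [Ux ix].
by split => //; exact: UU'.
Qed.

Lemma smooth_section_on_local U s :
  (forall x, U x -> exists2 U', U' x & smooth_section_on U' s) ->
  smooth_section_on U s.
Proof.
move=> H i; apply: smooth_map_on_local => x [Ux ix].
by have [U' U'x ss] := H x Ux; exists (U' `&` triv_dom i).
Qed.

Lemma eq_smooth_section_on U s s' : open U -> (forall x, U x -> s x = s' x) ->
  smooth_section_on U s -> smooth_section_on U s'.
Proof.
move=> oU ss' ss i; apply: eq_smooth_map_on (ss i) => [|x [Ux _]].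
  by apply: openI => //; exact: triv_open.
by rewrite ss'.
Qed.

Lemma smooth_section_on_sum U (I : finType) (c : I -> M -> R^o)
    (e : I -> bsection E) :
  open U -> (forall j, smooth_map_on U (c j)) ->
  (forall j, smooth_section_on U (e j)) ->
  smooth_section_on U (fun x => \sum_j (c j x : R) *: e j x).
Proof.
move=> oU sc se i.
have oUi : open (U `&` triv_dom i) by apply: openI => //; exact: triv_open.
apply/smooth_map_on_row => // m.
have scm j : smooth_map_on (U `&` triv_dom i) (c j).
  by apply: sub_smooth_map_on (sc j) => x [].
have sem j := (smooth_map_on_row _ oUi).1 (se j i) m.
apply: eq_smooth_map_on (smooth_map_on_sum oUi
  (fun j (_ : xpredT j) => smooth_map_onM oUi (scm j) (sem j))) => // x _.
rewrite linear_sum summxE; apply: eq_bigr => j _.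
by rewrite linearZ mxE.
Qed.

Definition local_frame (i : triv_index E) (m : 'I_(bundle_rank E)) :
  bsection E := fun x => (triv i x)^-1%VF (delta_mx 0 m).

Lemma smooth_local_frame i m : smooth_section_on (triv_dom i) (local_frame i m).
Proof. by move=> j; exact: triv_smooth. Qed.

Lemma trivK i x : triv_dom i x -> cancel (triv i x) (triv i x)^-1%VF.
Proof. by move=> /triv_bij/bij_inj/lker0P/eqP/eqP k0; exact: lker0_lfunK. Qed.

Lemma trivKV i x : triv_dom i x -> cancel (triv i x)^-1%VF (triv i x).
Proof.
move=> ix v; have [g _ gK] := triv_bij ix.
by rewrite -[v]gK trivK.
Qed.

Lemma local_frame_sum i x (v : 'rV_(bundle_rank E)) :
  \sum_m v 0 m *: local_frame i m x = (triv i x)^-1%VF v.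
Proof.
by rewrite [in RHS](row_sum_delta v) linear_sum; apply: eq_bigr => m _; rewrite linearZ.
Qed.

Lemma smooth_coordinates U i s : open U -> U `<=` triv_dom i ->
  smooth_mx_on U (fun x => triv i x (s x)) -> smooth_section_on U s.
Proof.
move=> oU Ui sc.
have se m : smooth_section_on U (local_frame i m).
  exact: sub_smooth_section_on Ui (smooth_local_frame i m).
apply: eq_smooth_section_on (smooth_section_on_sum oU (sc 0) se) => // x Ux.
by rewrite local_frame_sum trivK //; exact: Ui.
Qed.

End SmoothSections.

(** * Smoothness of the projection to [C_+] *)

Section SmoothProjections.
Variables (R : realType) (n : nat) (M : manifold R n) (E : exact_courant M).
Variable G : generalized_metric E.
Implicit Types (U : set M) (s : bsection E) (x : M).

Let nondeg x := pairing_nondegenerate E x.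
Let Cpos x := Cplus_positive (g := G) (x := x).
Let Cmax x := Cplus_maximal (g := G) (x := x).

(** Isotropy is exactness combined with [coanchorE]. Conversely, if [u] is orthogonal to every
    [pi^* xi], letting [xi] run over the coordinate functionals gives [pi u = 0]. *)
Lemma cotangent_lagrangian x (u : E x) :
  (u \in cotangent_part E x) <->
  (forall k, k \in cotangent_part E x -> pairing E x k u = 0).
Proof.
rewrite /cotangent_part; split=> [|Hu].
  rewrite {1}exactness memv_ker => /eqP u0 _ /memv_imgP[xi _ ->].
  by rewrite coanchorE u0 linear0.
rewrite exactness memv_ker; apply/eqP/rowP => j.
have l_linear : linear (fun v : tangent x => v 0 j : R^o).
  by move=> a v w; rewrite !mxE.
pose lM := GRing.isLinear.Build _ _ _ _ _ l_linear.
pose l : {linear tangent x -> R^o} := HB.pack (fun v : tangent x => v 0 j : R^o) lM.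
have := Hu (coanchor E x (linfun l)) (memv_img _ (memvf _)).
by rewrite coanchorE lfunE /= !mxE.
Qed.

Lemma cotangentE x (u : E x) :
  (u \in cotangent_part E x) = (anchor E x u == 0).
Proof. by rewrite /cotangent_part exactness memv_ker. Qed.

(** In a local frame [e] of [C_+], the coefficients of [P s] solve the linear system with Gram
    matrix [A] and right-hand side [<s, e_j>]. *)
Lemma smooth_Pplus : smooth_endomorphism (Pplus G).
Proof.
move=> U s oU ss; apply: smooth_section_on_local => x0 Ux0.
have [U0 [k [e [oU0 U0x0 se be]]]] := Cplus_smooth G x0.
pose U' := U `&` U0; exists U'; first by [].
have oU' : open U' by exact: openI.
have ss' : smooth_section_on U' s by apply: sub_smooth_section_on ss => x [].
have se' j : smooth_section_on U' (e j).
  by apply: sub_smooth_section_on (se j) => x [].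
pose A x : 'M[R]_k := \matrix_(i, j) pairing E x (e i x) (e j x).
pose w x : 'rV[R]_k := \row_j pairing E x (s x) (e j x).
pose c x : 'rV[R]_k :=
  \row_j vector.coord [tuple e i x | i < k] j (Pplus G x (s x)).
have eC x j : U' x -> e j x \in Cplus G x.
  by move=> [_ /be/basis_mem]; apply; apply: map_f; rewrite mem_enum.
have PE x : U' x -> \sum_j c x 0 j *: e j x = Pplus G x (s x).
  move=> U'x; have := be x U'x.2; move=> bx.
  rewrite [RHS](coord_basis bx); last exact: proj_plus_mem.
  by apply: eq_bigr => j _; rewrite mxE -tnth_nth tnth_mktuple.
have sumA x (v : 'rV[R]_k) j :
    (v *m A x) 0 j = pairing E x (\sum_i v 0 i *: e i x) (e j x).
  rewrite mxE form_suml; apply: eq_bigr => i _.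
  by rewrite formZl mxE.
have sc : smooth_mx_on U' c.
  apply: (smooth_solution (A := A) (w := w)) => //.
  - move=> i j; apply: eq_smooth_map_on (pairing_smooth oU' (se' i) (se' j)) => //.
    by move=> x _; rewrite mxE.
  - move=> i j; apply: eq_smooth_map_on (pairing_smooth oU' ss' (se' j)) => //.
    by move=> x _; rewrite mxE.
  (* A row vector killed by the Gram matrix gives a null vector [u] of [C_+], which is zero by
     definiteness. *)
  - move=> x U'x; apply: mulmx_inj_row_free => v vA0.
    set u := \sum_i v 0 i *: e i x.
    have uC : u \in Cplus G x by apply: memv_suml => i _; rewrite memvZ ?eC.
    have uu : pairing E x u u = 0.
      rewrite {2}/u form_sumr big1 // => i _.
      by rewrite formZr -sumA vA0 mxE mulr0.
    have u0 : u = 0.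
      by apply/eqP; apply: contraT => /(Cpos uC); rewrite uu ltxx.
    have /freeP fe := basis_free (be x U'x.2).
    apply/rowP => j; rewrite mxE; apply: (fe (v 0)).
    rewrite -[RHS]u0; apply: eq_bigr => i _.
    by rewrite -tnth_nth tnth_mktuple.
  - move=> x U'x; apply/rowP => j; rewrite sumA PE // mxE.
    by rewrite (form_plusl (Cpos (x := x))) proj_plus_id ?eC //; exact: Cpos.
apply: eq_smooth_section_on (smooth_section_on_sum oU' (sc 0) se') => //.
Qed.

End SmoothProjections.

Section SectionModule.
Variables (R : realType) (n : nat) (M : manifold R n) (E : vector_bundle M).
Implicit Types (U : set M) (s t : bsection E).

Lemma smooth_section_onD U s t : open U -> smooth_section_on U s ->
  smooth_section_on U t -> smooth_section_on U (sadd s t).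
Proof.
move=> oU ss st i.
have oUi : open (U `&` triv_dom i) by apply: openI => //; exact: triv_open.
apply: eq_smooth_map_on (smooth_map_onD oUi (ss i) (st i)) => // x _.
by rewrite /sadd linearD.
Qed.

Lemma smooth_section_onZ U (k : R) s : open U -> smooth_section_on U s ->
  smooth_section_on U (sscale (fun=> k) s).
Proof.
move=> oU ss.
have := smooth_section_on_sum (I := 'I_1) (c := fun _ _ => k) oU
  (fun=> smooth_map_on_cst U (k : R^o)) (fun=> ss).
by apply: eq_smooth_section_on => // x _; rewrite big_ord_recl big_ord0 addr0.
Qed.

End SectionModule.

Section SmoothSplitting.
Variables (R : realType) (n : nat) (M : manifold R n) (E : exact_courant M).
Variable G : generalized_metric E.
Implicit Types (U : set M) (s : bsection E) (x : M).

Let Cpos x := Cplus_positive (g := G) (x := x).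
Let nondeg x := pairing_nondegenerate E x.
Let Cmax x := Cplus_maximal (g := G) (x := x).

Local Notation P := (Pplus G).
Local Notation Q := (Pminus G).
Local Notation C := (splitting_involution G).

Lemma PplusQ x (u : E x) : P x u + Q x u = u.
Proof. exact: proj_add (Cpos (x := x)) u. Qed.

Lemma PplusK x (u : E x) : P x (P x u) = P x u.
Proof. exact: proj_plusK (Cpos (x := x)) u. Qed.

Lemma PminusK x (u : E x) : Q x (Q x u) = Q x u.
Proof. exact: proj_minusK (Cpos (x := x)) u. Qed.

Lemma Pplus_minus x (u : E x) : P x (Q x u) = 0.
Proof. exact: proj_plus_minus (Cpos (x := x)) u. Qed.

Lemma Pminus_plus x (u : E x) : Q x (P x u) = 0.
Proof. exact: proj_minus_plus (Cpos (x := x)) u. Qed.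

Lemma pairing_Pplus x (u v : E x) : pairing E x (P x u) v = pairing E x u (P x v).
Proof. exact: form_plusl (Cpos (x := x)) u v. Qed.

Lemma pairing_Pminus x (u v : E x) : pairing E x (Q x u) v = pairing E x u (Q x v).
Proof. exact: form_minusl (Cpos (x := x)) u v. Qed.

Lemma Pplus_anisotropic x (u : E x) : pairing E x (P x u) (P x u) = 0 -> P x u = 0.
Proof.
move=> uu; apply/eqP; apply: contraT.
by move=> /(Cpos (proj_plus_mem _ _ u)); rewrite [X in _ < X]uu ltxx.
Qed.

Lemma Pminus_anisotropic x (u : E x) : pairing E x (Q x u) (Q x u) = 0 -> Q x u = 0.
Proof.
move=> uu; apply/eqP; apply: contraT.
move=> /(orthov_negative_definite (nondeg x) (@Cpos x) (@Cmax x) (proj_minus_mem _ _ u)).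
by rewrite [X in X < _]uu ltxx.
Qed.

Lemma GendoE x (u : E x) : Gendo G x u = P x u - Q x u.
Proof. exact: metric_endoE. Qed.

Lemma GformE x (u v : E x) : Gform G x u v = pairing E x (Gendo G x u) v.
Proof. exact: metric_formE (@Cpos x) u v. Qed.

Lemma Gform_gt0 x (u : E x) : u != 0 -> 0 < Gform G x u u.
Proof. exact: metric_form_gt0 (nondeg x) (@Cpos x) (@Cmax x) u. Qed.

Lemma involution_Pminus x (u : E x) : C x (Q x u) = P x (C x u).
Proof.
exact: (involution_minus (nondeg x) (@Cpos x) (@Cmax x)
  (@cotangent_lagrangian _ _ _ _ x) u).
Qed.

Lemma involution_Pplus x (u : E x) : C x (P x u) = Q x (C x u).
Proof.
exact: (involution_plus (nondeg x) (@Cpos x) (@Cmax x)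
  (@cotangent_lagrangian _ _ _ _ x) u).
Qed.

Lemma anchor_involution x (u : E x) : anchor E x (C x u) = anchor E x u.
Proof.
apply/eqP; rewrite -subr_eq0 -linearB -cotangentE.
exact: (involution_sub_mem (nondeg x) (@Cpos x) (@Cmax x) _ u).
Qed.

Lemma anchor_proj_inj x (u : E x) :
  anchor E x (P x u) = 0 -> anchor E x (Q x u) = 0 -> u = 0.
Proof.
move=> /eqP; rewrite -cotangentE => Pu /eqP; rewrite -cotangentE => Qu.
exact: (lagrangian_proj_inj (nondeg x) (@Cpos x) (@Cmax x)
  (@cotangent_lagrangian _ _ _ _ x) Pu Qu).
Qed.

Lemma smooth_Pminus : smooth_endomorphism Q.
Proof.
move=> U s oU ss.
have := smooth_section_onD oU ss (smooth_section_onZ (-1) oU (smooth_Pplus G oU ss)).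
apply: eq_smooth_section_on => // x _.
by rewrite /sadd /sscale /sapply scaleN1r -{1}(PplusQ (s x)) addrC addKr.
Qed.

Lemma smooth_Gendo : smooth_endomorphism (Gendo G).
Proof.
move=> U s oU ss.
have := smooth_section_onD oU (smooth_Pplus G oU ss)
  (smooth_section_onZ (-1) oU (smooth_Pminus oU ss)).
apply: eq_smooth_section_on => // x _.
by rewrite /sadd /sscale /sapply scaleN1r GendoE.
Qed.

(* [C s] is determined by the two tangent fields [pi (P (C s)) = pi (Q s)] and
   [pi (Q (C s)) = pi (P s)]. *)
Lemma smooth_involution : smooth_endomorphism C.
Proof.
move=> U s oU ss; apply: smooth_section_on_local => x0 Ux0.
have [i ix0] := triv_cover E x0.
pose k := chart_at x0.
pose U' := U `&` (triv_dom i `&` dom k).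
have oU' : open U'.
  by apply: openI => //; apply: openI; [exact: triv_open|exact: dom_open].
exists U'; first by split=> //; split=> //; exact: mem_chart_at.
have ss' : smooth_section_on U' s by apply: sub_smooth_section_on ss => x [].
pose e m := local_frame i m.
have se' m : smooth_section_on U' (e m).
  by apply: sub_smooth_section_on (smooth_local_frame i m) => x [_ []].
(* Anchors are read in the fixed chart [k], since the representation through [chart_at x] need not
   vary smoothly with [x]. *)
pose X (F : endomorphism E) (t : bsection E) x : 'rV[R]_n :=
  components k (anchor E x (F x (t x))).
have sX F t : smooth_endomorphism F -> smooth_section_on U' t ->
    smooth_mx_on U' (X F t).
  move=> sF st a b; rewrite (ord1 a).
  have sv := anchor_smooth oU' (sF _ _ oU' st) k.
  have oU2 : open (U' `&` dom k) by apply: openI => //; exact: dom_open.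
  have := (smooth_map_on_row _ oU2).1 sv b.
  by apply: sub_smooth_map_on => x U'x; split=> //; have [_ []] := U'x.
pose A x : 'M[R]_(bundle_rank E, n + n) :=
  row_mx (\matrix_m X P (e m) x) (\matrix_m X Q (e m) x).
pose w x : 'rV[R]_(n + n) := row_mx (X Q s x) (X P s x).
pose c x : 'rV[R]_(bundle_rank E) := triv i x (C x (s x)).
have sumX (F : endomorphism E) x (v : 'rV[R]_(bundle_rank E)) :
    v *m (\matrix_m X F (e m) x) =
    components k (anchor E x (F x ((triv i x)^-1%VF v))).
  rewrite mulmx_sum_row -local_frame_sum !linear_sum.
  rewrite -[RHS](_ : components k (\sum_m v 0 m *: anchor E x (F x (e m x))) = _).
    by rewrite components_sum; apply: eq_bigr => m _; rewrite rowK.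
  by congr components; apply: eq_bigr => m _; rewrite !linearZ.
have sumA x (v : 'rV[R]_(bundle_rank E)) : v *m A x =
    row_mx (components k (anchor E x (P x ((triv i x)^-1%VF v))))
           (components k (anchor E x (Q x ((triv i x)^-1%VF v)))).
  by rewrite mul_mx_row !sumX.
have sc : smooth_mx_on U' c.
  apply: (smooth_solution (A := A) (w := w)) => //.
  - move=> a b; have [b' ->|b' ->] := split_ordP b.
      apply: eq_smooth_map_on (sX P (e a) (smooth_Pplus G) (se' a) 0 b') => //.
      by move=> x _; rewrite row_mxEl mxE.
    apply: eq_smooth_map_on (sX Q (e a) smooth_Pminus (se' a) 0 b') => //.
    by move=> x _; rewrite row_mxEr mxE.
  - move=> a b; rewrite (ord1 a); have [b' ->|b' ->] := split_ordP b.
      apply: eq_smooth_map_on (sX Q s smooth_Pminus ss' 0 b') => //.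
      by move=> x _; rewrite row_mxEl.
    apply: eq_smooth_map_on (sX P s (smooth_Pplus G) ss' 0 b') => //.
    by move=> x _; rewrite row_mxEr.
  (* Row-freeness is the injectivity of [u |-> (pi (P u), pi (Q u))]. *)
  - move=> x [_ [ix kx]]; apply: mulmx_inj_row_free => v.
    rewrite sumA -row_mx0 => /eq_row_mx[Pv Qv].
    rewrite -(trivKV ix v) (anchor_proj_inj (u := (triv i x)^-1%VF v)) ?linear0 //.
      exact: components_inj kx Pv.
    exact: components_inj kx Qv.
  - move=> x [_ [ix kx]]; rewrite sumA /c trivK // -involution_Pminus.
    by rewrite -involution_Pplus !anchor_involution.
by apply: (smooth_coordinates (i := i) oU') sc => x [_ []].
Qed.

End SmoothSplitting.

(** * Courant bracket *)

Section Differential.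
Variables (R : realType) (n : nat) (M : manifold R n).
Implicit Types (f g : M -> R) (x : M).

Lemma smooth_function_differentiable f x : smooth_function f ->
  differentiable (f \o param (chart_at x) : 'rV[R]_n -> R^o)
    (coord (chart_at x) x).
Proof.
move=> sf; have [+ _] := sf (chart_at x) 1%N; apply; exists x => //.
by split=> //; exact: mem_chart_at.
Qed.

Lemma differentialE f x (v : tangent x) :
  differential f x v
    = 'd (f \o param (chart_at x) : 'rV[R]_n -> R^o) (coord (chart_at x) x) v.
Proof. exact: lfunE. Qed.

Lemma differential_add f g x : smooth_function f -> smooth_function g ->
  differential (fun y => f y + g y) x = differential f x + differential g x.
Proof.
move=> /(smooth_function_differentiable x) df /(smooth_function_differentiable x) dg.
apply/lfunP => v; rewrite add_lfunE.
exact (etrans (differentialE (fun y => f y + g y) v)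
  (etrans (congr1 (fun F => F v) (diffD df dg))
    (esym (congr2 +%R (differentialE f v) (differentialE g v))))).
Qed.

Lemma differential_cst (c : R) x : differential (fun=> c) x = 0.
Proof.
apply/lfunP => v; rewrite zero_lfunE.
exact (etrans (differentialE (fun=> c) v)
  (congr1 (fun F => F v) (diff_cst (c : R^o) (coord (chart_at x) x)))).
Qed.

End Differential.

Section SectionOperations.
Variables (R : realType) (n : nat) (M : manifold R n) (E : vector_bundle M).
Implicit Types (a b : bsection E) (F : endomorphism E).

Definition sopp a : bsection E := sscale (fun=> -1) a.
Definition szero : bsection E := fun=> 0.

Lemma section_ext a b : (forall x, a x = b x) -> a = b.
Proof. exact: functional_extensionality_dep. Qed.

Lemma soppE a x : sopp a x = - a x.
Proof. by rewrite /sopp /sscale scaleN1r. Qed.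

Lemma smooth_sadd a b :
  smooth_section a -> smooth_section b -> smooth_section (sadd a b).
Proof. exact: smooth_section_onD openT. Qed.

Lemma smooth_sopp a : smooth_section a -> smooth_section (sopp a).
Proof. exact: smooth_section_onZ openT. Qed.

Lemma smooth_szero : smooth_section szero.
Proof.
move=> i; apply: (eq_smooth_map_on (f := fun=> 0)) => [|x _|].
- by apply: openI; [exact: openT|exact: triv_open].
- by rewrite linear0.
- exact: smooth_map_on_cst.
Qed.

Lemma smooth_sapply F a :
  smooth_endomorphism F -> smooth_section a -> smooth_section (sapply F a).
Proof. by move=> sF; exact: sF openT. Qed.

Lemma sapply_sadd F a b : sapply F (sadd a b) = sadd (sapply F a) (sapply F b).
Proof. by apply: section_ext => x; rewrite /sapply linearD. Qed.

Lemma sapply_sopp F a : sapply F (sopp a) = sopp (sapply F a).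
Proof. by apply: section_ext => x; rewrite /sapply !soppE linearN. Qed.

End SectionOperations.

Section CourantIdentities.
Variables (R : realType) (n : nat) (M : manifold R n) (E : exact_courant M).
Implicit Types (a b c d : bsection E) (x : M).
Local Notation smooth := smooth_section.

Lemma bracketDl a b c x : smooth a -> smooth b -> smooth c ->
  bracket (sadd a b) c x = bracket a c x + bracket b c x.
Proof.
move=> sa sb sc; have := bracketPl 1 sa sb sc x.
by rewrite scale1r [sscale _ _](_ : _ = a) //; apply: section_ext => y; exact: scale1r.
Qed.

Lemma bracketDr a b c x : smooth a -> smooth b -> smooth c ->
  bracket c (sadd a b) x = bracket c a x + bracket c b x.
Proof.
move=> sa sb sc; have := bracketPr 1 sa sb sc x.
by rewrite scale1r [sscale _ _](_ : _ = a) //; apply: section_ext => y; exact: scale1r.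
Qed.

Lemma sadd0 : sadd (@szero _ _ _ E) (@szero _ _ _ E) = @szero _ _ _ E.
Proof. by apply: section_ext => y; exact: addr0. Qed.

Lemma bracket0l c x : smooth c -> bracket (@szero _ _ _ E) c x = 0.
Proof.
move=> sc; have := bracketDl x (@smooth_szero _ _ _ E) (@smooth_szero _ _ _ E) sc.
by rewrite sadd0 -[LHS]addr0 => /addrI.
Qed.

Lemma bracket0r c x : smooth c -> bracket c (@szero _ _ _ E) x = 0.
Proof.
move=> sc; have := bracketDr x (@smooth_szero _ _ _ E) (@smooth_szero _ _ _ E) sc.
by rewrite sadd0 -[LHS]addr0 => /addrI.
Qed.

Lemma saddN a : sadd a (sopp a) = @szero _ _ _ E.
Proof. by apply: section_ext => y; rewrite /sadd soppE subrr. Qed.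

Lemma bracketNl a c x : smooth a -> smooth c ->
  bracket (sopp a) c x = - bracket a c x.
Proof.
move=> sa sc; apply: (addrI (bracket a c x)).
by rewrite -bracketDl ?saddN ?bracket0l ?subrr //; exact: smooth_sopp.
Qed.

Lemma bracketNr a c x : smooth a -> smooth c ->
  bracket c (sopp a) x = - bracket c a x.
Proof.
move=> sa sc; apply: (addrI (bracket c a x)).
by rewrite -bracketDr ?saddN ?bracket0r ?subrr //; exact: smooth_sopp.
Qed.

Lemma smooth_pairing a b : smooth a -> smooth b ->
  smooth_function (fun x => pairing E x (a x) (b x)).
Proof. by move=> sa sb; exact: pairing_smooth openT sa sb. Qed.

(** Polarization of the axiom [bracket_diag], applied to [a + b]. *)
Lemma bracket_polar a b x : smooth a -> smooth b ->
  bracket a b x + bracket b a x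
    = coanchor E x (differential (fun y => pairing E y (a y) (b y)) x).
Proof.
move=> sa sb; have sab := smooth_sadd sa sb.
pose f y := pairing E y (a y) (b y).
pose fa y := pairing E y (a y) (a y).
pose fb y := pairing E y (b y) (b y).
have sf : smooth_function f by exact: smooth_pairing.
have sfa : smooth_function fa by exact: smooth_pairing.
have sfb : smooth_function fb by exact: smooth_pairing.
have smD (g h : M -> R) : smooth_function g -> smooth_function h ->
    smooth_function (fun y => g y + h y).
  by move=> sg sh; exact: smooth_map_onD openT sg sh.
have := bracket_diag sab x.
rewrite bracketDl // !bracketDr // !bracket_diag //.
rewrite [fun y => pairing E y (sadd a b y) _](_ : _ =
  fun y => fa y + fb y + (f y + f y)); last first.
  apply/funext => y; rewrite /sadd formDl !formDr (formC _ (b y) (a y)).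
  by rewrite -!addrA; congr (_ + _); rewrite [RHS]addrCA; congr (_ + _); rewrite addrC.
have sff := smD _ _ sf sf.
rewrite (differential_add x (smD _ _ sfa sfb) sff) (differential_add x sfa sfb).
rewrite (differential_add x sf sf).
move: (differential fa x) (differential fb x) (differential f x) => da db d.
have cD u v : coanchor E x (u + v) = coanchor E x u + coanchor E x v.
  exact: linearD.
rewrite !cD; move: (coanchor E x da) (coanchor E x db) (coanchor E x d).
move=> {da db d} ca cb c.
rewrite [RHS]scalerDr scaler_half_add [X in _ = X + _]scalerDr.
rewrite [bracket b a x + _]addrC addrACA.
exact: addrI.
Qed.

(** By polarization the symmetric part of the bracket depends only on the function [<a, b>]. *)
Lemma bracket_sym_eq a b c d x :
  smooth a -> smooth b -> smooth c -> smooth d ->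
  (forall y, pairing E y (a y) (b y) = pairing E y (c y) (d y)) ->
  bracket a b x + bracket b a x = bracket c d x + bracket d c x.
Proof.
move=> sa sb sc sd ab_cd.
rewrite (bracket_polar x sa sb) (bracket_polar x sc sd).
exact (congr1 (fun f => coanchor E x (differential f x)) (funext ab_cd)).
Qed.

Lemma bracket_skew a b x : smooth a -> smooth b ->
  (forall y, pairing E y (a y) (b y) = 0) -> bracket a b x = - bracket b a x.
Proof.
move=> sa sb ab0; apply/eqP; rewrite -addr_eq0 bracket_polar //.
rewrite [fun y => _](_ : _ = fun=> 0); last by apply/funext.
by rewrite differential_cst linear0.
Qed.

Lemma bracket_pairing0 a b c x : smooth a -> smooth b -> smooth c ->
  (forall y, pairing E y (b y) (c y) = 0) ->
  pairing E x (bracket a b x) (c x) = - pairing E x (b x) (bracket a c x).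
Proof.
move=> sa sb sc bc0; apply/eqP; rewrite -addr_eq0 -bracket_pairing //.
rewrite [fun y => _](_ : _ = fun=> 0); last by apply/funext.
by rewrite differential_cst zero_lfunE.
Qed.

End CourantIdentities.

(** * Nijenhuis tensors *)

Ltac smooth_tac := solve [repeat lazymatch goal with
  | H : ?P |- ?P => exact H
  | |- smooth_section (sadd _ _) => apply: smooth_sadd
  | |- smooth_section (sopp _) => apply: smooth_sopp
  | |- smooth_section (szero _) => exact: smooth_szero
  | |- smooth_section (bracket _ _) => apply: bracket_smooth
  | |- smooth_section (sapply _ _) => apply: smooth_sapply
  | |- smooth_endomorphism (Pplus _) => exact: smooth_Pplus
  | |- smooth_endomorphism (Pminus _) => exact: smooth_Pminus
  | |- smooth_endomorphism (splitting_involution _) => exact: smooth_involution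
  end].

Section Nijenhuis.
Variables (R : realType) (n : nat) (M : manifold R n) (E : exact_courant M).
Implicit Types (a b c : bsection E) (x : M).
Local Notation smooth := smooth_section.

(** Nondegeneracy turns identities between vectors into scalar identities, which [ring] and [lra]
    can settle. *)
Lemma pairing_ext x (u v : E x) :
  (forall w, pairing E x u w = pairing E x v w) -> u = v.
Proof.
move=> uv; apply/eqP; rewrite -subr_eq0; apply/eqP.
apply: (form0_nondegenerate (pairing_nondegenerate E x)) => w.
by rewrite formBl uv subrr.
Qed.

Definition nijenhuis (J : endomorphism E) a b : bsection E := fun x =>
  bracket (sapply J a) (sapply J b) x - bracket a b x
  - J x (bracket (sapply J a) b x + bracket a (sapply J b) x).

Section AlmostComplex.
Variable J : endomorphism E.
Hypothesis hJ : almost_generalized_complex J.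

Let sJ : smooth_endomorphism J. Proof. by case: hJ. Qed.

Lemma complexK x (u : E x) : J x (J x u) = - u.
Proof. by case: hJ. Qed.

Lemma pairing_complex x (u v : E x) :
  pairing E x (J x u) (J x v) = pairing E x u v.
Proof. by case: hJ. Qed.

Lemma pairing_complexl x (u v : E x) :
  pairing E x (J x u) v = - pairing E x u (J x v).
Proof. by rewrite -pairing_complex complexK formNl. Qed.

Lemma sapply_complexK a : sapply J (sapply J a) = sopp a.
Proof. by apply: section_ext => x; rewrite soppE /sapply complexK. Qed.

Lemma nijenhuisDl a b c x : smooth a -> smooth b -> smooth c ->
  nijenhuis J (sadd a b) c x = nijenhuis J a c x + nijenhuis J b c x.
Proof.
move=> sa sb sc; rewrite /nijenhuis !sapply_sadd !bracketDl; try smooth_tac.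
apply: pairing_ext => w; rewrite !linearD /= !(formDl, formNl); ring.
Qed.

Lemma nijenhuisDr a b c x : smooth a -> smooth b -> smooth c ->
  nijenhuis J c (sadd a b) x = nijenhuis J c a x + nijenhuis J c b x.
Proof.
move=> sa sb sc; rewrite /nijenhuis !sapply_sadd !bracketDr; try smooth_tac.
apply: pairing_ext => w; rewrite !linearD /= !(formDl, formNl); ring.
Qed.

(** Since [<J a, J b> = <a, b>] and [<J a, b> = - <a, J b>], the symmetric parts of the brackets
    cancel in pairs by [bracket_sym_eq]. *)
Lemma nijenhuis_skew a b x : smooth a -> smooth b ->
  nijenhuis J a b x = - nijenhuis J b a x.
Proof.
move=> sa sb; rewrite /nijenhuis.
have e1 : bracket (sapply J a) (sapply J b) x + bracket (sapply J b) (sapply J a) x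
    = bracket a b x + bracket b a x.
  apply: bracket_sym_eq; try smooth_tac; move=> y.
  by rewrite /sapply pairing_complex.
have e2 : bracket (sapply J a) b x + bracket b (sapply J a) x
    = - (bracket a (sapply J b) x + bracket (sapply J b) a x).
  rewrite opprD -bracketNr -?bracketNl; try smooth_tac.
  apply: bracket_sym_eq; try smooth_tac; move=> y.
  by rewrite soppE /sapply pairing_complexl formNr.
apply: pairing_ext => w.
have := congr1 (fun u => pairing E x u w) e1.
have := congr1 (fun u => pairing E x u (J x w)) e2.
rewrite !(formDl, formNl, pairing_complexl); lra.
Qed.

Lemma in_LP (u : csection E) : in_L J u <-> u.2 = sopp (sapply J u.1).
Proof.
case: u => u1 u2; rewrite /in_L /csapply /csscale /=; split=> [[e1 _]|->].
  apply: section_ext => x; rewrite soppE e1.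
  by rewrite scale0r scale1r sub0r opprK.
by congr pair; apply: section_ext => x;
  rewrite ?sapply_sopp ?sapply_complexK !soppE scale0r scale1r ?opprK ?sub0r ?add0r ?opprK.
Qed.

Lemma generalized_complexP : generalized_complex J <->
  (forall a b, smooth a -> smooth b -> forall x, nijenhuis J a b x = 0).
Proof.
(* Real and imaginary parts of the bracket of [a - i J a] and [b - i J b]: membership in [L] asks
   that the second be [- J] of the first, which is [J N_J (a, b) = 0]. *)
have key a b x : smooth a -> smooth b ->
    (nijenhuis J a b x = 0 <->
    bracket a (sopp (sapply J b)) x + bracket (sopp (sapply J a)) b x
    = - J x (bracket a b x - bracket (sopp (sapply J a)) (sopp (sapply J b)) x)).
  move=> sa sb; rewrite !bracketNr ?bracketNl; try smooth_tac.
  rewrite /nijenhuis opprK; split=> e; apply: pairing_ext => w.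
    have := congr1 (fun u => pairing E x u (J x w)) e.
    rewrite !(formDl, formNl, form0l, pairing_complexl) !complexK !formNr; lra.
  have := congr1 (fun u => pairing E x u (J x w)) e.
  rewrite !(formDl, formNl, form0l, pairing_complexl) !complexK !formNr; lra.
split=> [[_ closed] a b sa sb x|N0].
  apply/key => //.
  pose u : csection E := (a, sopp (sapply J a)).
  pose v : csection E := (b, sopp (sapply J b)).
  have /in_LP : in_L J (cbracket u v).
    by apply: closed; rewrite ?in_LP //; split=> /=; smooth_tac.
  by rewrite /= => /(congr1 (fun s => s x)); rewrite soppE.
split=> // -[a a'] [b b'] [/= sa _] [/= sb _] /in_LP/= -> /in_LP/= ->.
apply/in_LP => /=; apply: section_ext => x; rewrite soppE.
by apply/key; [|exact: sb|exact: N0].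
Qed.

End AlmostComplex.
End Nijenhuis.

(** * Orthogonal splittings and the twisted structure [J'] *)

Section Splitting.
Variables (R : realType) (n : nat) (M : manifold R n) (E : exact_courant M).
Implicit Types (a b c : bsection E) (P Q J : endomorphism E) (x : M).
Local Notation smooth := smooth_section.

(** The properties of [C_+] and [C_-] on which integrability rests, in a form symmetric in [P] and
    [Q]: anisotropy replaces the two opposite definiteness conditions, so each result for one
    subbundle holds for the other. *)
Record orthogonal_splitting P Q : Prop := OrthogonalSplitting {
  smooth_projl : smooth_endomorphism P;
  smooth_projr : smooth_endomorphism Q;
  projD : forall x (u : E x), P x u + Q x u = u;
  projlK : forall x (u : E x), P x (P x u) = P x u;
  projrK : forall x (u : E x), Q x (Q x u) = Q x u;
  projlr : forall x (u : E x), P x (Q x u) = 0;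
  projrl : forall x (u : E x), Q x (P x u) = 0;
  projl_adj : forall x (u v : E x),
    pairing E x (P x u) v = pairing E x u (P x v);
  projr_adj : forall x (u v : E x),
    pairing E x (Q x u) v = pairing E x u (Q x v);
  projl_aniso : forall x (u : E x),
    pairing E x (P x u) (P x u) = 0 -> P x u = 0;
  projr_aniso : forall x (u : E x),
    pairing E x (Q x u) (Q x u) = 0 -> Q x u = 0
}.

Lemma orthogonal_splitting_sym P Q :
  orthogonal_splitting P Q -> orthogonal_splitting Q P.
Proof. by case=> *; split=> // x u; rewrite addrC. Qed.

Definition commutes_with J P := forall x (u : E x), J x (P x u) = P x (J x u).

(** For the projections to [C_+] and [C_-] this is [J G], which is [J' = G J] once [J] commutes with
    [G]. *)
Definition twist J P Q : endomorphism E := fun x => (J x \o (P x - Q x))%VF.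

(** One half of [D J = 0]; [parallel_bismutP] combines the two halves. *)
Definition mixed_parallel J P Q := forall a b, smooth a -> smooth b ->
  forall x, J x (P x (bracket (sapply Q a) (sapply P b) x))
    = P x (bracket (sapply Q a) (sapply J (sapply P b)) x).

Section Twist.
Variables (J P Q : endomorphism E).
Hypothesis hJ : almost_generalized_complex J.
Hypothesis hPQ : orthogonal_splitting P Q.
Hypotheses (JP : commutes_with J P) (JQ : commutes_with J Q).
Local Notation K := (twist J P Q).

Let sJ : smooth_endomorphism J. Proof. by case: hJ. Qed.
Let sP : smooth_endomorphism P. Proof. by case: hPQ. Qed.
Let sQ : smooth_endomorphism Q. Proof. by case: hPQ. Qed.

Lemma twistE x (u : E x) : K x u = J x (P x u) - J x (Q x u).
Proof. by rewrite /twist comp_lfunE add_lfunE opp_lfunE linearB. Qed.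

Lemma projl_twist x (u : E x) : P x (K x u) = J x (P x u).
Proof.
by rewrite twistE linearB /= -!JP (projlK hPQ) (projlr hPQ) linear0 subr0.
Qed.

Lemma projr_twist x (u : E x) : Q x (K x u) = - J x (Q x u).
Proof.
by rewrite twistE linearB /= -!JQ (projrK hPQ) (projrl hPQ) linear0 sub0r.
Qed.

Lemma sapply_comm a : sapply J (sapply P a) = sapply P (sapply J a).
Proof. by apply: section_ext => x; exact: JP. Qed.

Lemma sapply_commr a : sapply J (sapply Q a) = sapply Q (sapply J a).
Proof. by apply: section_ext => x; exact: JQ. Qed.

Lemma twist_projl a : sapply K (sapply P a) = sapply J (sapply P a).
Proof.
apply: section_ext => x.
by rewrite /sapply twistE (projlK hPQ) (projrl hPQ) linear0 subr0.
Qed.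

Lemma twist_projr a : sapply K (sapply Q a) = sopp (sapply J (sapply Q a)).
Proof.
apply: section_ext => x.
by rewrite soppE /sapply twistE (projrK hPQ) (projlr hPQ) linear0 sub0r.
Qed.

Lemma pairing_projlr x (u v : E x) : pairing E x (P x u) (Q x v) = 0.
Proof. by rewrite (projl_adj hPQ) (projlr hPQ) form0r. Qed.

Lemma pairing_projrl x (u v : E x) : pairing E x (Q x u) (P x v) = 0.
Proof. by rewrite formC pairing_projlr. Qed.

Lemma twist_almost_complex : almost_generalized_complex K.
Proof.
split.
- move=> U s oU ss.
  have := smooth_section_onD oU (sJ oU (sP oU ss))
    (smooth_section_onZ (-1) oU (sJ oU (sQ oU ss))).
  apply: eq_smooth_section_on => // x _.
  by rewrite /sadd /sscale /sapply scaleN1r twistE.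
- move=> x u v; rewrite !twistE !formBl !formBr !(pairing_complex hJ).
  rewrite pairing_projlr pairing_projrl.
  rewrite -[in RHS](projD hPQ u) -[in RHS](projD hPQ v) !formDl !formDr.
  rewrite pairing_projlr pairing_projrl; ring.
- move=> x u; rewrite twistE projl_twist projr_twist linearN opprK.
  by rewrite /= !(complexK hJ) -opprD (projD hPQ).
Qed.

(* Projecting [N_J + N_K = 0] to the image of [P]. *)
Lemma integrable_mixed_parallel :
  (forall a b, smooth a -> smooth b -> forall x, nijenhuis J a b x = 0) ->
  (forall a b, smooth a -> smooth b -> forall x, nijenhuis K a b x = 0) ->
  mixed_parallel J P Q.
Proof.
move=> NJ NK a b sa sb x.
have sZ : smooth (sapply Q a) by smooth_tac.
have sW : smooth (sapply P b) by smooth_tac.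
have := NJ _ _ sZ sW x; have := NK _ _ sZ sW x.
rewrite /nijenhuis twist_projl twist_projr !bracketNl; try smooth_tac.
move=> /(congr1 (P x)) eK /(congr1 (P x)) eJ.
move: eK eJ; rewrite !linearB /= projl_twist linear0 -JP.
set p := bracket (sapply J _) (sapply J _) x.
set q := bracket _ _ x.
set r := bracket _ _ x.
set s := bracket _ _ x.
(* With [Z = Q a] and [W = P b], the sum of the equations is [- 2 (P [Z, W] + J P [Z, J W]) = 0].
   Pairing with [J w] applies [J] to it, up to sign. *)
move=> eK eJ; apply: pairing_ext => w.
have := congr1 (fun u => pairing E x u (J x w)) eK.
have := congr1 (fun u => pairing E x u (J x w)) eJ.
rewrite !linearD !linearN /= !(formDl, formNl, form0l) !(pairing_complexl hJ).
rewrite !(complexK hJ) !formNr; lra.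
Qed.

(** [K] is [- J] on the first argument and [J] on the second. Using [mixed_parallel] at [a] and at
    [J a] to pull [J] out of the brackets makes the four terms cancel in pairs. *)
Lemma projl_nijenhuis_twist a b x : mixed_parallel J P Q ->
  smooth a -> smooth b -> P x (nijenhuis K (sapply Q a) (sapply P b) x) = 0.
Proof.
move=> mp sa sb.
have e1 := mp a b sa sb x.
have e2 := mp (sapply J a) b (smooth_sapply sJ sa) sb x.
rewrite -sapply_commr in e2.
rewrite /nijenhuis twist_projl twist_projr !bracketNl; try smooth_tac.
rewrite !linearB /= projl_twist !linearD !linearN /= -e1 -e2.
rewrite (complexK hJ).
by apply: pairing_ext => w; rewrite !(formDl, formNl, form0l); ring.
Qed.

(* For [c] in the image of [Q], the pairing of [[J P a, J P b]] with [c] is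
   [<J P b, [c, J P a]> = <P b, [c, P a]>]. *)
Lemma projr_bracket_complex a b x : mixed_parallel J P Q ->
  smooth a -> smooth b ->
  Q x (bracket (sapply J (sapply P a)) (sapply J (sapply P b)) x)
    = Q x (bracket (sapply P a) (sapply P b) x).
Proof.
move=> mp sa sb.
have pair0 b' c' y : pairing E y (sapply P b' y) (sapply Q c' y) = 0.
  exact: pairing_projlr.
(* Invariance of the pairing, then skewness of the bracket on orthogonal sections, bring the bracket
   to the mixed form controlled by [mixed_parallel]. *)
have move_bracket a' b' c' : smooth a' -> smooth b' -> smooth c' ->
    pairing E x (bracket (sapply P a') (sapply P b') x) (sapply Q c' x)
    = pairing E x (b' x) (P x (bracket (sapply Q c') (sapply P a') x)).
  move=> sa' sb' sc'.
  rewrite bracket_pairing0 //; try smooth_tac.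
  rewrite bracket_skew //; try smooth_tac.
  by rewrite formNr opprK (projl_adj hPQ).
pose p := bracket (sapply J (sapply P a)) (sapply J (sapply P b)).
pose q := bracket (sapply P a) (sapply P b).
(* Testing against the difference [c] itself suffices, as the pairing is anisotropic on the image of
   [Q]. *)
pose c := sadd p (sopp q).
have sc : smooth c by rewrite /c /p /q; smooth_tac.
have Qc0 : Q x (c x) = 0.
  apply: (projr_aniso hPQ); rewrite {1}/c /sadd soppE linearB /=.
  rewrite formBl !(projr_adj hPQ) (projrK hPQ) -/(sapply Q c x).
  rewrite /p /q !sapply_comm !move_bracket //; try smooth_tac.
  by rewrite -sapply_comm -mp // (pairing_complex hJ) subrr.
apply/eqP; rewrite -subr_eq0 -linearB; apply/eqP.
by move: Qc0; rewrite /c /sadd soppE.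
Qed.

End Twist.
End Splitting.

Section TwistIntegrability.
Variables (R : realType) (n : nat) (M : manifold R n) (E : exact_courant M).
Implicit Types (a b c : bsection E) (P Q J : endomorphism E) (x : M).
Local Notation smooth := smooth_section.

(** On the image of [P] the twist is [J], so its Nijenhuis tensor differs from [N_J] by [2 J Q r].
    The [Q]-part of [N_J = 0] together with [projr_bracket_complex] gives [J Q r = 0]. *)
Lemma nijenhuis_twist_same J P Q a b x :
  almost_generalized_complex J -> orthogonal_splitting P Q ->
  commutes_with J P -> commutes_with J Q -> mixed_parallel J P Q ->
  (forall a b, smooth a -> smooth b -> forall x, nijenhuis J a b x = 0) ->
  smooth a -> smooth b ->
  nijenhuis (twist J P Q) (sapply P a) (sapply P b) x = 0.
Proof.
move=> hJ hPQ JP JQ mp NJ sa sb; have [sJ _ _] := hJ; have [sP sQ] := hPQ.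
move=> _ _ _ _ _ _ _ _ _.
have e := projr_bracket_complex hJ hPQ JP x mp sa sb.
have := NJ (sapply P a) (sapply P b) (smooth_sapply sP sa) (smooth_sapply sP sb) x.
rewrite /nijenhuis !(twist_projl J hPQ).
move: e; set p := bracket (sapply J _) (sapply J _) x.
set q := bracket (sapply P a) (sapply P b) x; set r := _ + _ => e N0.
rewrite -[LHS](projD hPQ).
have /(congr1 (P x)) := N0; have /(congr1 (Q x)) := N0.
rewrite !linearB !linear0 /= (projl_twist hPQ JP) // (projr_twist hPQ JQ) // -JP -JQ.
rewrite e => eQ ->; rewrite add0r opprK.
by move: eQ; rewrite subrr sub0r => /eqP; rewrite oppr_eq0 => /eqP ->; rewrite addr0.
Qed.

(** Exchanging [P] and [Q] changes the sign of the twist, and [nijenhuis] is even in its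
    endomorphism. *)
Lemma nijenhuis_twist_sym J P Q a b x :
  almost_generalized_complex (twist J P Q) -> smooth a -> smooth b ->
  nijenhuis (twist J Q P) a b x = nijenhuis (twist J P Q) a b x.
Proof.
move=> [sK _ _] sa sb; rewrite /nijenhuis.
have KN y (u : E y) : twist J Q P y u = - twist J P Q y u.
  by rewrite !twistE opprB.
have sKN c : sapply (twist J Q P) c = sopp (sapply (twist J P Q) c).
  by apply: section_ext => y; rewrite soppE /sapply KN.
rewrite !sKN KN !bracketNl ?bracketNr ?opprK; try smooth_tac.
by rewrite -opprD linearN.
Qed.

(** The [P]-part is [projl_nijenhuis_twist]; after a swap of the arguments by skewness, the [Q]-part
    is the same lemma with [P] and [Q] exchanged. *)
Lemma nijenhuis_twist_mixed J P Q a b x :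
  almost_generalized_complex J -> orthogonal_splitting P Q ->
  commutes_with J P -> commutes_with J Q ->
  mixed_parallel J P Q -> mixed_parallel J Q P -> smooth a -> smooth b ->
  nijenhuis (twist J P Q) (sapply Q a) (sapply P b) x = 0.
Proof.
move=> hJ hPQ JP JQ mp mq sa sb; have hQP := orthogonal_splitting_sym hPQ.
have hK := twist_almost_complex hJ hPQ JP JQ.
have sPb : smooth (sapply P b) by apply: smooth_sapply sb; case: hPQ.
have sQa : smooth (sapply Q a) by apply: smooth_sapply sa; case: hPQ.
rewrite -[LHS](projD hPQ) (projl_nijenhuis_twist hJ hPQ) // add0r.
rewrite (nijenhuis_skew hK) // -nijenhuis_twist_sym // linearN /=.
by rewrite (projl_nijenhuis_twist hJ hQP) // oppr0.
Qed.

Lemma twist_integrable J P Q :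
  almost_generalized_complex J -> orthogonal_splitting P Q ->
  commutes_with J P -> commutes_with J Q ->
  mixed_parallel J P Q -> mixed_parallel J Q P ->
  (forall a b, smooth a -> smooth b -> forall x, nijenhuis J a b x = 0) ->
  forall a b, smooth a -> smooth b ->
  forall x, nijenhuis (twist J P Q) a b x = 0.
Proof.
move=> hJ hPQ JP JQ mp mq NJ a b sa sb x.
have hQP := orthogonal_splitting_sym hPQ.
have hK := twist_almost_complex hJ hPQ JP JQ.
have sP : smooth_endomorphism P by case: hPQ.
have sQ : smooth_endomorphism Q by case: hPQ.
have split c : c = sadd (sapply P c) (sapply Q c).
  by apply: section_ext => y; rewrite /sadd /sapply (projD hPQ).
rewrite (split a) (split b) (nijenhuisDl hK) ?(nijenhuisDr hK); try smooth_tac.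
rewrite nijenhuis_twist_same // nijenhuis_twist_mixed //.
rewrite (nijenhuis_skew hK); try smooth_tac.
rewrite nijenhuis_twist_mixed // oppr0 !add0r.
(* What remains is the component with both arguments in the image of [Q], which is the first case
   with [P] and [Q] exchanged. *)
rewrite -(nijenhuis_twist_sym x hK); try smooth_tac.
by rewrite nijenhuis_twist_same.
Qed.

End TwistIntegrability.

(** * The generalized Bismut connection and its torsion *)

Section BismutConnection.
Variables (R : realType) (n : nat) (M : manifold R n) (E : exact_courant M).
Variable G : generalized_metric E.
Implicit Types (a b c : bsection E) (x : M).
Local Notation smooth := smooth_section.
Local Notation P := (Pplus G).
Local Notation Q := (Pminus G).
Local Notation C := (splitting_involution G).
Local Notation D := (bismut G).

Lemma generalized_metric_splitting : orthogonal_splitting P Q.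
Proof.
split.
- exact: smooth_Pplus.
- exact: smooth_Pminus.
- exact: PplusQ.
- exact: PplusK.
- exact: PminusK.
- exact: Pplus_minus.
- exact: Pminus_plus.
- exact: pairing_Pplus.
- exact: pairing_Pminus.
- exact: Pplus_anisotropic.
- exact: Pminus_anisotropic.
Qed.

Lemma sapply_involution_Pminus a :
  sapply C (sapply Q a) = sapply P (sapply C a).
Proof. by apply: section_ext => x; exact: involution_Pminus. Qed.

Lemma sapply_involution_Pplus a :
  sapply C (sapply P a) = sapply Q (sapply C a).
Proof. by apply: section_ext => x; exact: involution_Pplus. Qed.

Lemma sapply_szero (F : endomorphism E) :
  sapply F (@szero _ _ _ E) = @szero _ _ _ E.
Proof. by apply: section_ext => x; exact: linear0. Qed.

Lemma sapply_Pplus_minus a : sapply P (sapply Q a) = @szero _ _ _ E.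
Proof. by apply: section_ext => x; exact: Pplus_minus. Qed.

Lemma sapply_Pminus_plus a : sapply Q (sapply P a) = @szero _ _ _ E.
Proof. by apply: section_ext => x; exact: Pminus_plus. Qed.

Lemma sapply_PplusK a : sapply P (sapply P a) = sapply P a.
Proof. by apply: section_ext => x; exact: PplusK. Qed.

Lemma sapply_PminusK a : sapply Q (sapply Q a) = sapply Q a.
Proof. by apply: section_ext => x; exact: PminusK. Qed.

Lemma bismut_minus_plus a b x : smooth a -> smooth b ->
  D (sapply Q a) (sapply P b) x = P x (bracket (sapply Q a) (sapply P b) x).
Proof.
move=> sa sb; rewrite /bismut.
rewrite sapply_Pplus_minus sapply_Pminus_plus sapply_PplusK sapply_PminusK.
rewrite sapply_szero !bracket0r ?bracket0l; try smooth_tac.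
by rewrite !linear0 !addr0.
Qed.

Lemma bismut_plus_minus a b x : smooth a -> smooth b ->
  D (sapply P a) (sapply Q b) x = Q x (bracket (sapply P a) (sapply Q b) x).
Proof.
move=> sa sb; rewrite /bismut.
rewrite sapply_Pplus_minus sapply_Pminus_plus sapply_PplusK sapply_PminusK.
rewrite sapply_szero !bracket0r ?bracket0l; try smooth_tac.
by rewrite !linear0 !addr0 add0r.
Qed.

Lemma bismutDl a b c x : smooth a -> smooth b -> smooth c ->
  D (sadd a b) c x = D a c x + D b c x.
Proof.
move=> sa sb sc; rewrite /bismut !sapply_sadd !bracketDl; try smooth_tac.
by apply: pairing_ext => w; rewrite !linearD /= !formDl; ring.
Qed.

Lemma bismutDr a b c x : smooth a -> smooth b -> smooth c ->
  D c (sadd a b) x = D c a x + D c b x.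
Proof.
move=> sa sb sc; rewrite /bismut !sapply_sadd !bracketDr; try smooth_tac.
by apply: pairing_ext => w; rewrite !linearD /= !formDl; ring.
Qed.

Lemma parallel_bismutP J : almost_generalized_complex J ->
  commutes_with J P -> commutes_with J Q ->
  (parallel D J <-> mixed_parallel J P Q /\ mixed_parallel J Q P).
Proof.
move=> [sJ _ _] JP JQ.
have sJP b : sapply J (sapply P b) = sapply P (sapply J b) by exact: sapply_comm.
have sJQ b : sapply J (sapply Q b) = sapply Q (sapply J b).
  by apply: section_ext => x; exact: JQ.
split=> [DJ|[mp mq] a b sa sb x].
  split=> a b sa sb x.
    rewrite sJP -!bismut_minus_plus; try smooth_tac.
    by rewrite -DJ ?sJP //; smooth_tac.
  rewrite sJQ -!bismut_plus_minus; try smooth_tac.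
  by rewrite -DJ ?sJQ //; smooth_tac.
have sCa : smooth (sapply C a) by smooth_tac.
(* As [C Q = P C] and [C P = Q C], the last two terms of [D] are mixed brackets with [C a] in place
   of [a]. *)
rewrite /bismut sapply_involution_Pminus sapply_involution_Pplus.
by rewrite -sJP -sJQ -!mp -?mq // !linearD.
Qed.

End BismutConnection.

(** * Type decomposition of trilinear forms *)

Lemma sum_bool3 (V : nmodType) (F : bool * bool * bool -> V) :
  \sum_e F e =
    F (true, true, true) + F (true, true, false)
    + (F (true, false, true) + F (true, false, false))
    + (F (false, true, true) + F (false, true, false)
    + (F (false, false, true) + F (false, false, false))).
Proof.
transitivity (\sum_i \sum_j F (i, j)).
  by rewrite pair_bigA; apply: eq_bigr => -[].
transitivity (\sum_i \sum_k \sum_j F ((i, k), j)); last by rewrite !big_bool.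
rewrite [RHS](pair_bigA _ (fun i k => \sum_j F ((i, k), j))).
by apply: eq_bigr => -[].
Qed.

Lemma complex_half (R : rcfType) : 2^-1 = Complex (2^-1 : R) 0 :> R[i].
Proof.
by rewrite -[RHS]/(real_complex R 2^-1) fmorphV rmorph_nat.
Qed.

Lemma complex_opp_i (R : rcfType) : - Complex (0 : R) 1 = Complex (- 0) (- 1).
Proof. by []. Qed.

Section TypeDecomposition.
Variables (R : realType) (n : nat) (M : manifold R n) (E : exact_courant M).
Variable J : endomorphism E.
Hypothesis hJ : almost_generalized_complex J.
Variable T : bsection E -> bsection E -> bsection E -> M -> R.
Implicit Types (a b c : bsection E) (u v w : csection E) (x : M).
Local Notation smooth := smooth_section.

Hypothesis TDl : forall a a' b c x, smooth a -> smooth a' -> smooth b ->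
  smooth c -> T (sadd a a') b c x = T a b c x + T a' b c x.
Hypothesis TDm : forall a b b' c x, smooth a -> smooth b -> smooth b' ->
  smooth c -> T a (sadd b b') c x = T a b c x + T a b' c x.
Hypothesis TDr : forall a b c c' x, smooth a -> smooth b -> smooth c ->
  smooth c' -> T a b (sadd c c') x = T a b c x + T a b c' x.

Let sJ : smooth_endomorphism J. Proof. by case: hJ. Qed.
Local Notation zero := (@szero _ _ _ E).

Let T0l b c x : smooth b -> smooth c -> T zero b c x = 0.
Proof.
move=> sb sc; have := TDl x (@smooth_szero _ _ _ E) (@smooth_szero _ _ _ E) sb sc.
by rewrite sadd0 -[LHS]addr0 => /addrI.
Qed.

Let T0m a c x : smooth a -> smooth c -> T a zero c x = 0.
Proof.
move=> sa sc; have := TDm x sa (@smooth_szero _ _ _ E) (@smooth_szero _ _ _ E) sc.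
by rewrite sadd0 -[LHS]addr0 => /addrI.
Qed.

Let T0r a b x : smooth a -> smooth b -> T a b zero x = 0.
Proof.
move=> sa sb; have := TDr x sa sb (@smooth_szero _ _ _ E) (@smooth_szero _ _ _ E).
by rewrite sadd0 -[LHS]addr0 => /addrI.
Qed.

Let TNl a b c x : smooth a -> smooth b -> smooth c ->
  T (sopp a) b c x = - T a b c x.
Proof.
move=> sa sb sc; apply: (addrI (T a b c x)).
by rewrite -TDl ?saddN ?T0l ?subrr; try smooth_tac.
Qed.

Let TNm a b c x : smooth a -> smooth b -> smooth c ->
  T a (sopp b) c x = - T a b c x.
Proof.
move=> sa sb sc; apply: (addrI (T a b c x)).
by rewrite -TDm ?saddN ?T0m ?subrr; try smooth_tac.
Qed.

Let TNr a b c x : smooth a -> smooth b -> smooth c ->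
  T a b (sopp c) x = - T a b c x.
Proof.
move=> sa sb sc; apply: (addrI (T a b c x)).
by rewrite -TDr ?saddN ?T0r ?subrr; try smooth_tac.
Qed.

(* Four times the (3,0) + (0,3) component of [T] on real sections. *)
Definition pure_type a b c x : R :=
  T a b c x - T a (sapply J b) (sapply J c) x
  - T (sapply J a) b (sapply J c) x - T (sapply J a) (sapply J b) c x.

Local Notation CT := (ctrilinear T).

(** [a - i J a] in [L] for [bar = false], [a + i J a] in its conjugate for [bar = true]. *)
Definition eigensection (bar : bool) a : csection E :=
  (a, if bar then sapply J a else sopp (sapply J a)).

Lemma type_projE bar u : smooth_csection u ->
  exists2 a, smooth a & type_proj J bar u = eigensection bar a.
Proof.
move=> [su1 su2].
(* The witness is the real part of the projection, which determines a section of either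
   eigenbundle. *)
exists (sscale (fun=> 2^-1)
  (sadd u.1 (if bar then sopp (sapply J u.2) else sapply J u.2))).
  apply: smooth_section_onZ; first exact: openT.
  by case: bar => /=; apply: smooth_sadd => //; try smooth_tac.
rewrite /type_proj complex_half; case: u su1 su2 => u1 u2 /= su1 su2.
case: bar; rewrite ?complex_opp_i /csscale /csadd /csapply /=;
  congr pair; apply: section_ext => x; apply: pairing_ext => w;
  rewrite ?soppE /sapply /sscale /sadd ?soppE /sapply;
  rewrite !(linearD, linearN, linearZ) /= ?(complexK hJ);
  rewrite !(formDl, formNl, formZl); ring.
Qed.

Lemma type_proj_add u :
  csadd (type_proj J true u) (type_proj J false u) = u.
Proof.
rewrite /type_proj complex_half complex_opp_i; case: u => u1 u2.
rewrite /csscale /csadd /csapply /=.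
congr pair; apply: section_ext => x; apply: pairing_ext => w;
  rewrite /sapply /sadd;
  rewrite !(formDl, formNl, formZl); lra.
Qed.

Lemma type_proj_eigensection bar a :
  type_proj J bar (eigensection false a)
    = if bar then (zero, zero) else eigensection false a.
Proof.
rewrite /type_proj complex_half complex_opp_i /eigensection.
case: bar; rewrite /csscale /csadd /csapply /=;
  congr pair; apply: section_ext => x; apply: pairing_ext => w;
  rewrite /sapply /sadd ?soppE ?linearN /= ?(complexK hJ) ?/szero;
  rewrite !(formDl, formNl, formZl, form0l); lra.
Qed.

(** Replacing [a] by [J a] multiplies the first eigensection by [- i] if [bar = true] and by [i]
    otherwise, so the imaginary part is, up to sign, the real part at [J a]. Vanishing of
    [pure_type] on all sections therefore controls both. *)
Lemma ctrilinear_eigensection bar a b c x : smooth a -> smooth b -> smooth c ->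
  CT (eigensection bar a) (eigensection bar b) (eigensection bar c) x
    = Complex (pure_type a b c x)
        ((-1) ^+ (~~ bar) * pure_type (sapply J a) b c x).
Proof.
move=> sa sb sc; rewrite /ctrilinear /eigensection /pure_type.
case: bar => /=; congr Complex.
- rewrite !(sapply_complexK hJ) !TNl; try smooth_tac; ring.
- rewrite !(TNl, TNm, TNr); try smooth_tac; ring.
- rewrite !(sapply_complexK hJ) !(TNl, TNm, TNr); try smooth_tac; ring.
Qed.

Lemma ctrilinearDl u u' v w x : smooth_csection u -> smooth_csection u' ->
  smooth_csection v -> smooth_csection w ->
  CT (csadd u u') v w x = CT u v w x + CT u' v w x.
Proof.
move=> [? ?] [? ?] [? ?] [? ?]; rewrite /ctrilinear /csadd /= !TDl //.
by apply/eqP; rewrite eq_complex /=; apply/andP; split; apply/eqP; ring.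
Qed.

Lemma ctrilinearDm u v v' w x : smooth_csection u -> smooth_csection v ->
  smooth_csection v' -> smooth_csection w ->
  CT u (csadd v v') w x = CT u v w x + CT u v' w x.
Proof.
move=> [? ?] [? ?] [? ?] [? ?]; rewrite /ctrilinear /csadd /= !TDm //.
by apply/eqP; rewrite eq_complex /=; apply/andP; split; apply/eqP; ring.
Qed.

Lemma ctrilinearDr u v w w' x : smooth_csection u -> smooth_csection v ->
  smooth_csection w -> smooth_csection w' ->
  CT u v (csadd w w') x = CT u v w x + CT u v w' x.
Proof.
move=> [? ?] [? ?] [? ?] [? ?]; rewrite /ctrilinear /csadd /= !TDr //.
by apply/eqP; rewrite eq_complex /=; apply/andP; split; apply/eqP; ring.
Qed.

Lemma smooth_type_proj bar u : smooth_csection u ->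
  smooth_csection (type_proj J bar u).
Proof.
move=> /(type_projE bar)[a sa ->]; split=> //=.
by case: bar => /=; smooth_tac.
Qed.

Lemma ctrilinear_type_sum u v w x : smooth_csection u -> smooth_csection v ->
  smooth_csection w ->
  CT u v w x = \sum_(e : bool * bool * bool)
    CT (type_proj J e.1.1 u) (type_proj J e.1.2 v) (type_proj J e.2 w) x.
Proof.
move=> su sv sw; have sp := smooth_type_proj.
rewrite -[in LHS](type_proj_add u) -[in LHS](type_proj_add v).
rewrite -[in LHS](type_proj_add w) sum_bool3 /=.
rewrite !ctrilinearDl ?ctrilinearDm ?ctrilinearDr ?type_proj_add //; exact: sp.
Qed.

Lemma of_type_criterion u v w x : smooth_csection u -> smooth_csection v ->
  smooth_csection w ->
  (CT u v w x = type_component J 2 CT u v w x + type_component J 1 CT u v w x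
  <-> CT (type_proj J true u) (type_proj J true v) (type_proj J true w) x
    + CT (type_proj J false u) (type_proj J false v) (type_proj J false w) x = 0).
Proof.
move=> su sv sw; rewrite ctrilinear_type_sum // /type_component.
rewrite [X in _ = X + _]big_mkcond [X in _ = _ + X]big_mkcond !sum_bool3 /=.
(* [t1] and [t8] are the terms with all three projections to the conjugate of [L], respectively to
   [L]; the other six make up the components of type (2,1) and (1,2). *)
set t1 := CT _ _ _ x; set t2 := CT _ _ _ x; set t3 := CT _ _ _ x.
set t4 := CT _ _ _ x; set t5 := CT _ _ _ x; set t6 := CT _ _ _ x.
set t7 := CT _ _ _ x; set t8 := CT _ _ _ x.
rewrite !(addr0, add0r); split=> [e|e].
  have -> : t1 + t8 = t1 + t2 + (t3 + t4) + (t5 + t6 + (t7 + t8))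
    - (t2 + t3 + t5 + (t4 + (t6 + t7))) by ring.
  by rewrite e; ring.
transitivity ((t1 + t8) + (t2 + t3 + t4 + t5 + t6 + t7)); first by ring.
by rewrite e; ring.
Qed.

Lemma of_type_21_12P : of_type_21_12 J T <->
  (forall a b c, smooth a -> smooth b -> smooth c -> forall x,
    pure_type a b c x = 0).
Proof.
split=> [H a b c sa sb sc x|H u v w su sv sw x].
  have es s : smooth s -> smooth_csection (eigensection false s).
    by move=> ss; split=> //=; smooth_tac.
  (* Sections of [L] have no component in the conjugate, so only the [L]-term is left, and its real
     part is [pure_type a b c]. *)
  have /of_type_criterion := H _ _ _ (es a sa) (es b sb) (es c sc) x.
  rewrite !type_proj_eigensection /= => /(_ (es a sa) (es b sb) (es c sc)).
  rewrite {1}/ctrilinear /= !T0l ?T0m; try smooth_tac.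
  rewrite ctrilinear_eigensection // => /eqP; rewrite eq_complex /= => /andP[].
  by rewrite !subr0 add0r => /eqP.
apply/of_type_criterion => //.
have [a sa ea] := type_projE true su; have [a' sa' ea'] := type_projE false su.
have [b sb eb] := type_projE true sv; have [b' sb' eb'] := type_projE false sv.
have [c sc ec] := type_projE true sw; have [c' sc' ec'] := type_projE false sw.
rewrite ea ea' eb eb' ec ec' !ctrilinear_eigensection // !H; try smooth_tac.
by apply/eqP; rewrite eq_complex /= !mulr0 !addr0 eqxx.
Qed.

End TypeDecomposition.

(** * Torsion of a connection with [D J = 0], and compatibility of [J] with the metric *)

Section TorsionType.
Variables (R : realType) (n : nat) (M : manifold R n) (E : exact_courant M).
Implicit Types (a b c : bsection E) (x : M) (J : endomorphism E).
Local Notation smooth := smooth_section.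

Lemma smooth_nijenhuis J a b : smooth_endomorphism J ->
  smooth a -> smooth b -> smooth (nijenhuis J a b).
Proof.
move=> sJ sa sb.
have -> : nijenhuis J a b =
    sadd (sadd (bracket (sapply J a) (sapply J b)) (sopp (bracket a b)))
      (sopp (sapply J (sadd (bracket (sapply J a) b) (bracket a (sapply J b))))).
  by apply: section_ext => x; rewrite /nijenhuis /sadd !soppE.
by smooth_tac.
Qed.

(* All the terms of the torsion involving the connection cancel in
   [pure_type], because [J] is parallel and skew-adjoint. *)
Lemma pure_type_torsion J (D : bsection E -> bsection E -> bsection E) a b c x :
  almost_generalized_complex J -> parallel D J ->
  smooth a -> smooth b -> smooth c ->
  pure_type J (torsion D) a b c x = pairing E x (nijenhuis J a b x) (c x).
Proof.
move=> hJ DJ sa sb sc; have [sJ _ _] := hJ.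
have DJE s t y : smooth s -> smooth t -> D s (sapply J t) y = J y (D s t y).
  by move=> ss st; exact: DJ.
(* [torsion] contains the skew bracket, so the computation produces the antisymmetrization of
   [N_J]. *)
have skew : pairing E x (nijenhuis J a b x) (c x)
    = 2^-1 * (pairing E x (nijenhuis J a b x) (c x)
             - pairing E x (nijenhuis J b a x) (c x)).
  by rewrite [in RHS](nijenhuis_skew hJ x sb sa) formNl; field.
rewrite skew /pure_type /torsion /skew_bracket /nijenhuis.
rewrite !DJE; try smooth_tac.
rewrite !(formDl, formNl, formZl, pairing_complexl hJ).
rewrite /sapply.
rewrite !(complexK hJ) !formNr.
lra.
Qed.

Section Additivity.
Variable D : bsection E -> bsection E -> bsection E.
Hypothesis DDl : forall a b c x, smooth a -> smooth b -> smooth c ->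
  D (sadd a b) c x = D a c x + D b c x.
Hypothesis DDr : forall a b c x, smooth a -> smooth b -> smooth c ->
  D c (sadd a b) x = D c a x + D c b x.

Lemma torsionDl a a' b c x : smooth a -> smooth a' -> smooth b -> smooth c ->
  torsion D (sadd a a') b c x = torsion D a b c x + torsion D a' b c x.
Proof.
move=> sa sa' sb sc; rewrite /torsion /skew_bracket.
rewrite !DDl // !DDr // bracketDl // bracketDr // /sadd.
by rewrite !(formDl, formNl, formZl, formDr); ring.
Qed.

Lemma torsionDm a b b' c x : smooth a -> smooth b -> smooth b' -> smooth c ->
  torsion D a (sadd b b') c x = torsion D a b c x + torsion D a b' c x.
Proof.
move=> sa sb sb' sc; rewrite /torsion /skew_bracket.
rewrite !DDl // !DDr // bracketDl // bracketDr // /sadd.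
by rewrite !(formDl, formNl, formZl, formDr); ring.
Qed.

Lemma torsionDr a b c c' x : smooth a -> smooth b -> smooth c -> smooth c' ->
  torsion D a b (sadd c c') x = torsion D a b c x + torsion D a b c' x.
Proof.
move=> sa sb sc sc'; rewrite /torsion /skew_bracket.
rewrite !DDl // /sadd.
by rewrite !(formDl, formNl, formZl, formDr); ring.
Qed.

End Additivity.

Variable G : generalized_metric E.

Variable J : endomorphism E.
Hypothesis hJ : almost_generalized_complex J.
Hypothesis hGJ : metric_orthogonal G J.

(** [J] preserves both [Gform] and the pairing, and [Gendo] relates the two. *)
Lemma metric_orthogonal_comm x (u : E x) :
  Gendo G x (J x u) = J x (Gendo G x u).
Proof.
apply: pairing_ext => w.
have -> : w = J x (- J x w) by rewrite linearN /= (complexK hJ) opprK.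
by rewrite -GformE hGJ GformE (pairing_complex hJ).
Qed.

(** [2 P = 1 + G], obtained by adding the identities for [P + Q] and [P - Q]. *)
Lemma complex_Pplus : commutes_with J (Pplus G).
Proof.
move=> x u; have := metric_orthogonal_comm u; rewrite !GendoE linearB /=.
have := congr1 (J x) (PplusQ G u); rewrite -[RHS](PplusQ G (J x u)) linearD /=.
move=> e1 e2; apply: pairing_ext => w.
have := congr1 (fun v => pairing E x v w) e1.
have := congr1 (fun v => pairing E x v w) e2.
rewrite !(formDl, formNl); lra.
Qed.

Lemma complex_Pminus : commutes_with J (Pminus G).
Proof.
move=> x u; apply: (addrI (J x (Pplus G x u))).
by rewrite -linearD PplusQ complex_Pplus PplusQ.
Qed.

Lemma Gendo_complexE :
  (fun x => (Gendo G x \o J x)%VF) = twist J (Pplus G) (Pminus G).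
Proof.
apply: functional_extensionality_dep => x; apply/lfunP => u.
by rewrite comp_lfunE GendoE twistE complex_Pplus complex_Pminus.
Qed.

(** The test sections [c] are global and smooth. For [N = nijenhuis J a b], the section [G N] is
    one, and [<N, G N>] is positive wherever [N] is nonzero. *)
Lemma nijenhuis0_of_pairing a b : smooth a -> smooth b ->
  (forall c, smooth c ->
    forall x, pairing E x (nijenhuis J a b x) (c x) = 0) ->
  forall x, nijenhuis J a b x = 0.
Proof.
move=> sa sb N0 x; have [sJ _ _] := hJ.
have sN := smooth_nijenhuis sJ sa sb.
have := N0 _ (smooth_sapply (@smooth_Gendo _ _ _ _ G) sN) x.
rewrite /sapply formC -GformE => NN; apply/eqP; apply: contraT.
by move=> /(@Gform_gt0 _ _ _ _ G x); rewrite NN ltxx.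
Qed.

End TorsionType.

(** * The equivalence, assembled from both halves of [D J = 0] and the type criterion *)

Theorem theorem6p1 (R : realType) (n : nat) (M : manifold R n)
    (E : exact_courant M) (G : generalized_metric E) (J : endomorphism E)
    (hJ : almost_generalized_complex J) (hGJ : metric_orthogonal G J) :
  defines_generalized_kahler J G <->
  parallel (bismut G) J /\ of_type_21_12 J (torsion (bismut G)).
Proof.
have JP := complex_Pplus hJ hGJ; have JQ := complex_Pminus hJ hGJ.
have hPQ := generalized_metric_splitting G.
have hQP := orthogonal_splitting_sym hPQ.
have hK := twist_almost_complex hJ hPQ JP JQ.
have DDl := @bismutDl _ _ _ _ G; have DDr := @bismutDr _ _ _ _ G.
have typeP := of_type_21_12P hJ (torsionDl DDl DDr) (torsionDm DDl DDr)
  (torsionDr DDl).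
rewrite /defines_generalized_kahler (Gendo_complexE hJ hGJ).
split=> [[/(generalized_complexP hJ) NJ /(generalized_complexP hK) NK _ _]|].
  (* Integrability of [- J'], the twist with [P] and [Q] exchanged, gives the half of [D J = 0] on
     [C_-]. *)
  have NK' a b : smooth_section a -> smooth_section b ->
      forall x, nijenhuis (twist J (Pminus G) (Pplus G)) a b x = 0.
    by move=> sa sb x; rewrite nijenhuis_twist_sym // NK.
  have DJ : parallel (bismut G) J.
    apply/(parallel_bismutP hJ JP JQ); split.
      exact: (integrable_mixed_parallel hJ hPQ JP).
    exact: (integrable_mixed_parallel hJ hQP JQ).
  split=> //; apply/typeP => a b c sa sb sc x.
  by rewrite pure_type_torsion // NJ // form0l.
move=> [DJ /typeP type0].
have [mp mq] := (parallel_bismutP hJ JP JQ).1 DJ.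
have NJ a b : smooth_section a -> smooth_section b ->
    forall x, nijenhuis J a b x = 0.
  move=> sa sb; apply: (nijenhuis0_of_pairing G hJ sa sb) => c sc x.
  by rewrite -(pure_type_torsion x hJ DJ) // type0.
split.
- exact/generalized_complexP.
- by apply/generalized_complexP => // *; exact: twist_integrable.
- move=> x a; rewrite !twistE linearB /=.
  by rewrite !JP !JQ.
(* [<J a, G J b> = <J a, J G b> = <a, G b>], so the metric of the pair is [G] itself. *)
exists G => x a b; rewrite -(Gendo_complexE hJ hGJ) comp_lfunE.
by rewrite (metric_orthogonal_comm hJ hGJ) (pairing_complex hJ) formC -GformE formC.
Qed.
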